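(* Let $P$ be a hyperbolic three-holed sphere with boundary components $a,b,c$, where $a,b,c$ are also used to denote corresponding elements of $\pi_1(P)$ with $c=(ab)^{-1}$. Let $\gamma$ be a closed geodesic in $P$ freely homotopic to $a^{-1}b$. Then the length of $\gamma$ satisfies $$\cosh\frac{\ell(\gamma)}{2}=2\cosh\frac{\ell(a)}{2}\cosh\frac{\ell(b)}{2}+\cosh\frac{\ell(c)}{2}.$$
   Context: $\ell(\cdot)$ denotes hyperbolic length; the boundary components of $P$ are geodesics, where a boundary component may degenerate to a cusp, in which case its length is $0$. *)

(* Defs.v *)
From mathcomp Require Import all_boot all_order all_algebra.
From mathcomp Require Import all_classical all_reals all_analysis.

Set Implicit Arguments.
Unset Strict Implicit.
Unset Printing Implicit Defensive.

Import Order.TTheory GRing.Theory Num.Theory.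
Import numFieldNormedType.Exports.

Local Open Scope classical_set_scope.
Local Open Scope ring_scope.

Definition coshR (R : realType) (x : R) : R := (expR x + expR (- x)) / 2.

(* Only meaningful for 1 <= x. *)
Definition arcoshR (R : realType) (x : R) : R :=
  ln (x + Num.sqrt (x ^+ 2 - 1)).

(* Upper half-plane model of the hyperbolic plane; (x, y) stands for x + iy. *)
Definition halfplane (R : realType) : set (R * R) := [set z | 0 < z.2].

Definition hdist (R : realType) (z w : R * R) : R :=
  arcoshR (1 + ((z.1 - w.1) ^+ 2 + (z.2 - w.2) ^+ 2) / (2 * z.2 * w.2)).

(* Real and imaginary parts of (az + b) / (cz + d), for ad - bc = 1. *)
Definition mobius (R : realType) (g : 'M[R]_2) (z : R * R) : R * R :=
  let a := g ord0 ord0 in let b := g ord0 ord_max in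
  let c := g ord_max ord0 in let d := g ord_max ord_max in
  let den := (c * z.1 + d) ^+ 2 + (c * z.2) ^+ 2 in
  (((a * z.1 + b) * (c * z.1 + d) + a * c * z.2 ^+ 2) / den, z.2 / den).

Definition geodesic_line (R : realType) (s : R -> R * R) : Prop :=
  (forall t, halfplane (s t)) /\ (forall t u, hdist (s t) (s u) = `|t - u|).

(* A closed convex region with nonempty interior whose frontier in the
   hyperbolic plane is a (possibly empty) union of complete geodesics. *)
Record geodesic_domain (R : realType) (X : set (R * R)) : Prop := {
  gd_sub : X `<=` @halfplane R;
  gd_closed : @halfplane R `&` closure X `<=` X;
  gd_interior : X° !=set0;
  gd_convex : forall (s : R -> R * R) (t u v : R), geodesic_line s ->
    X (s t) -> X (s v) -> t <= u <= v -> X (s u);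
  gd_frontier : forall x, X x -> ~ X° x -> exists s : R -> R * R,
    [/\ geodesic_line s, s 0 = x & forall t, X (s t) /\ ~ X° (s t)] }.

Variant hole := hole_a | hole_b | hole_c.

(* The three holes are the open unit discs around 2 and -2 and the exterior,
   on the sphere, of the closed disc of radius 5 around 0: the level vanishes
   on the bounding circle and is negative in the hole. *)
Definition hole_level (R : realType) (i : hole) (z : R * R) : R :=
  match i with
  | hole_a => (z.1 - 2) ^+ 2 + z.2 ^+ 2 - 1
  | hole_b => (z.1 + 2) ^+ 2 + z.2 ^+ 2 - 1
  | hole_c => 25 - (z.1 ^+ 2 + z.2 ^+ 2)
  end.

(* The circle bounding hole i belongs to the surface unless i is a cusp, in
   which case it is deleted, leaving a puncture up to homeomorphism. *)
Definition three_holed_sphere (R : realType) (cusp : hole -> bool) :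
    set (R * R) :=
  [set z | forall i, if cusp i then 0 < hole_level i z
                     else 0 <= hole_level i z].

(* For a projection p : X -> P and a marking m of P by a planar model: the
   horoball k{y > Y} embeds in P modulo the parabolic conjugate by k of
   z |-> z + 1, as a neighbourhood of the puncture i, with y --> +oo going to
   the puncture. *)
Definition cusp_chart (R : realType) (P : Type) (X : set (R * R))
    (p : R * R -> P) (m : P -> R * R) (i : hole) (k : 'M[R]_2) (Y : R) : Prop :=
  [/\ \det k = 1, 0 < Y,
    (forall z, Y < z.2 -> X (mobius k z)),
    (forall z w, Y < z.2 -> Y < w.2 ->
      (p (mobius k z) = p (mobius k w) <->
       exists n : int, w = (z.1 + n%:~R, z.2))) &
    (forall e, 0 < e -> exists Y', forall z, Y < z.2 -> Y' < z.2 ->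
      hole_level i (m (p (mobius k z))) < e) /\
    (exists2 e, 0 < e & forall q, hole_level i (m q) < e ->
      exists2 z, Y < z.2 & p (mobius k z) = q)].

(* Hyperbolic three-holed spheres: P = X / G with X a convex region of the
    hyperbolic plane with geodesic boundary (the universal cover of P) and G a
    group of orientation-preserving isometries acting freely and properly
    discontinuously on X.  The group G lives in SL_2 and acts through PSL_2;
    it may or may not contain -1. *)
Record hyp_pants (R : realType) := HypPants {
  hp_space :> topologicalType;
  hp_dom : set (R * R);
  hp_grp : set 'M[R]_2;
  (* the covering map, relevant on hp_dom only *)
  hp_proj : R * R -> hp_space;
  hp_cusp : hole -> bool;
  (* a homeomorphism onto the model, and its inverse *)
  hp_mark : hp_space -> R * R;
  hp_unmark : R * R -> hp_space;

  hp_domP : geodesic_domain hp_dom;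
  hp_grp_det : forall g, hp_grp g -> \det g = 1;
  hp_grp1 : hp_grp 1%:M;
  hp_grpM : forall g g', hp_grp g -> hp_grp g' -> hp_grp (g *m g');
  hp_grpV : forall g, hp_grp g -> hp_grp (invmx g);
  hp_grp_act : forall g x, hp_grp g -> hp_dom x -> hp_dom (mobius g x);
  hp_grp_free : forall x, hp_dom x -> exists2 U, nbhs x U &
    forall g z, hp_grp g -> hp_dom z -> U z -> U (mobius g z) ->
      g = 1%:M \/ g = - 1%:M;

  hp_proj_surj : forall q, exists2 x, hp_dom x & hp_proj x = q;
  hp_proj_eq : forall x y, hp_dom x -> hp_dom y ->
    (hp_proj x = hp_proj y <-> exists2 g, hp_grp g & y = mobius g x);
  (* the topology of P is the quotient topology *)
  hp_proj_open : forall U : set hp_space, open U <->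
    exists2 V : set (R * R), open V & hp_dom `&` hp_proj @^-1` U
                                      = hp_dom `&` V;

  hp_mark_cont : continuous hp_mark;
  hp_unmark_cont :
    {within three_holed_sphere hp_cusp, continuous hp_unmark};
  hp_mark_sub : forall q, three_holed_sphere hp_cusp (hp_mark q);
  hp_markK : cancel hp_mark hp_unmark;
  hp_unmarkK : forall z, three_holed_sphere hp_cusp z ->
    hp_mark (hp_unmark z) = z;
  (* the boundary circles form the geodesic boundary *)
  hp_mark_bd : forall x, hp_dom x ->
    (~ hp_dom° x <-> exists i, hole_level i (hp_mark (hp_proj x)) = 0);

  (* no funnels: an end of P is a cusp *)
  hp_cuspP : forall i, hp_cusp i ->
    exists k Y, cusp_chart hp_dom hp_proj hp_mark i k Y }.

(* Paths are total functions on R, of which only the values on [0, 1] matter. *)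
Definition is_loop (R : realType) (T : topologicalType) (f : R -> T) : Prop :=
  {within `[0, 1], continuous f} /\ f 0 = f 1.

Definition loop_at (R : realType) (T : topologicalType) (x : T) (f : R -> T) :
    Prop :=
  is_loop f /\ f 0 = x.

Definition loop_inv (R : realType) (T : topologicalType) (f : R -> T) : R -> T :=
  fun t => f (1 - t).

Definition loop_mul (R : realType) (T : topologicalType) (f g : R -> T) :
    R -> T :=
  fun t => if t <= 2^-1 then f (2 * t) else g (2 * t - 1).

Definition loop_homotopic (R : realType) (T : topologicalType) (x : T)
    (f g : R -> T) : Prop :=
  exists F : R * R -> T,
    [/\ {within `[0, 1] `*` `[0, 1], continuous F},
      forall t, 0 <= t <= 1 -> F (0, t) = f t,
      forall t, 0 <= t <= 1 -> F (1, t) = g t &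
      forall s, 0 <= s <= 1 -> F (s, 0) = x /\ F (s, 1) = x].

Definition freely_homotopic (R : realType) (T : topologicalType)
    (f g : R -> T) : Prop :=
  exists F : R * R -> T,
    [/\ {within `[0, 1] `*` `[0, 1], continuous F},
      forall t, 0 <= t <= 1 -> F (0, t) = f t,
      forall t, 0 <= t <= 1 -> F (1, t) = g t &
      forall s, 0 <= s <= 1 -> F (s, 0) = F (s, 1)].

(* gam is a closed geodesic of P of length L, with constant speed and period 1;
   the geodesics of P are the projections of those of X. *)
Definition closed_geodesic (R : realType) (P : hyp_pants R) (gam : R -> P)
    (L : R) : Prop :=
  [/\ 0 < L, forall t, gam (t + 1) = gam t &
    exists s : R -> R * R, [/\ geodesic_line s, forall t, hp_dom P (s t) &
      forall t, gam t = hp_proj P (s (L * t))]].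

(* bd runs once, in either direction, around the boundary component i of P,
   whose length is L; around a cusp, bd is a horocycle, and L = 0. *)
Definition boundary_curve (R : realType) (P : hyp_pants R) (i : hole)
    (bd : R -> P) (L : R) : Prop :=
  if hp_cusp P i then
    L = 0 /\ exists k Y y,
      [/\ cusp_chart (hp_dom P) (@hp_proj _ P) (@hp_mark _ P) i k Y, Y < y &
        (forall t, bd t = hp_proj P (mobius k (t, y))) \/
        (forall t, bd t = hp_proj P (mobius k (- t, y)))]
  else
    [/\ closed_geodesic bd L,
      bd @` `[0, 1] = [set q : P | hole_level i (hp_mark q) = 0] &
      forall t u, 0 <= t < 1 -> 0 <= u < 1 -> bd t = bd u -> t = u].

(* Main.v *)
(* A deck transformation is a matrix of SL_2 up to sign, and
   tr (A^-1 B) = tr A tr B - tr (A B), so with |tr A| = 2 cosh (l_a / 2) and so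
   on, only the sign of tr A tr B tr (A B) matters.  Normalise A, B, C to have
   positive traces, so that A B C = 1 or -1; the formula is the case -1.
   To exclude A B C = 1, write A = cosh (l_a / 2) + sinh (l_a / 2) s N_a, where
   N_a is the spacelike normal vector of the axis of A pointing towards the
   universal cover X of P (X is convex and the axis is in its boundary, so X is
   on one side of it), and s = 1 or -1 is the direction of translation; a cusp
   gives a null vector instead.  As the axes are disjoint components of the
   boundary of X, the product <N_a, N_b> is at most -1, and negative when there is a
   cusp.  Hence tr (A B) is at most 2 cosh ((l_a - l_b) / 2) if the two
   directions agree, and at least 2 cosh ((l_a + l_b) / 2) otherwise.  If
   A B C = 1, the three resulting relations between l_a, l_b and l_c, with
   tr (A B) = 2 cosh (l_c / 2), are incompatible for any choice of directions.
   In particular no orientation argument in P is needed. *)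
Require Import Defs.
From mathcomp Require Import all_boot all_order all_algebra.
From mathcomp Require Import all_classical all_reals all_analysis.
From mathcomp Require Import ring lra.
Set Implicit Arguments.
Unset Strict Implicit.
Unset Printing Implicit Defensive.
Import Order.TTheory GRing.Theory Num.Theory.
Import numFieldNormedType.Exports.
Local Open Scope classical_set_scope.
Local Open Scope ring_scope.

(** * Two-by-two matrices of determinant 1 *)

Definition mx2 (R : realType) (a b c d : R) : 'M[R]_2 :=
  \matrix_(i, j) if i == ord0 then (if j == ord0 then a else b)
                 else (if j == ord0 then c else d).

Lemma mx2_eta (R : realType) (g : 'M[R]_2) :
  g = mx2 (g ord0 ord0) (g ord0 ord_max) (g ord_max ord0) (g ord_max ord_max).
Proof.
apply/matrixP => i j; rewrite mxE.
by case: i => [] [|[|//]] hi; case: j => [] [|[|//]] hj /=;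
  congr (g _ _); apply: val_inj.
Qed.

Lemma mul_mx2 (R : realType) (a b c d a' b' c' d' : R) :
  mx2 a b c d *m mx2 a' b' c' d' =
  mx2 (a * a' + b * c') (a * b' + b * d') (c * a' + d * c') (c * b' + d * d').
Proof.
apply/matrixP => i j; rewrite !mxE !big_ord_recl big_ord0 !mxE /= addr0.
by case: (i == ord0); case: (j == ord0).
Qed.

Lemma add_mx2 (R : realType) (a b c d a' b' c' d' : R) :
  mx2 a b c d + mx2 a' b' c' d' = mx2 (a + a') (b + b') (c + c') (d + d').
Proof.
by apply/matrixP => i j; rewrite !mxE; case: (i == ord0); case: (j == ord0).
Qed.

Lemma scale_mx2 (R : realType) (e a b c d : R) :
  e *: mx2 a b c d = mx2 (e * a) (e * b) (e * c) (e * d).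
Proof.
by apply/matrixP => i j; rewrite !mxE; case: (i == ord0); case: (j == ord0).
Qed.

Lemma opp_mx2 (R : realType) (a b c d : R) :
  - mx2 a b c d = mx2 (- a) (- b) (- c) (- d).
Proof.
by apply/matrixP => i j; rewrite !mxE; case: (i == ord0); case: (j == ord0).
Qed.

Lemma one_mx2 (R : realType) : 1%:M = mx2 1 0 0 1 :> 'M[R]_2.
Proof.
apply/matrixP => i j; rewrite !mxE.
by case: i => [] [|[|//]] hi; case: j => [] [|[|//]] hj.
Qed.

Lemma mxtrace_mx2 (R : realType) (a b c d : R) : \tr (mx2 a b c d) = a + d.
Proof. by rewrite /mxtrace !big_ord_recl big_ord0 !mxE /= addr0. Qed.

Lemma det_mx2 (R : realType) (a b c d : R) : \det (mx2 a b c d) = a * d - b * c.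
Proof.
rewrite (expand_det_row _ ord0) !big_ord_recl big_ord0 /cofactor !det_mx11.
by rewrite !mxE /=; ring.
Qed.

Lemma mx2_inj (R : realType) (a b c d a' b' c' d' : R) :
  mx2 a b c d = mx2 a' b' c' d' -> [/\ a = a', b = b', c = c' & d = d'].
Proof.
move/matrixP => h.
by move: (h ord0 ord0) (h ord0 ord_max) (h ord_max ord0) (h ord_max ord_max);
  rewrite !mxE.
Qed.

Lemma mx2_det1_unit (R : realType) (g : 'M[R]_2) : \det g = 1 -> g \in unitmx.
Proof. by rewrite unitmxE => ->; rewrite unitr1. Qed.

Lemma det1M (R : realType) (g h : 'M[R]_2) :
  \det g = 1 -> \det h = 1 -> \det (g *m h) = 1.
Proof. by move=> hg hh; rewrite det_mulmx hg hh mulr1. Qed.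

Lemma det1V (R : realType) (g : 'M[R]_2) : \det g = 1 -> \det (invmx g) = 1.
Proof. by move=> hg; rewrite det_inv hg invr1. Qed.

Lemma invmx_mx2 (R : realType) (a b c d : R) : a * d - b * c = 1 ->
  invmx (mx2 a b c d) = mx2 d (- b) (- c) a.
Proof.
move=> e; have u : mx2 a b c d \in unitmx by rewrite mx2_det1_unit ?det_mx2.
rewrite -[RHS]mul1mx -(mulVmx u) -mulmxA mul_mx2 -[LHS]mulmx1 one_mx2.
by congr (_ *m mx2 _ _ _ _); rewrite -?e; ring.
Qed.

Lemma invmx_mul (R : realType) (g h : 'M[R]_2) : \det g = 1 -> \det h = 1 ->
  invmx (g *m h) = invmx h *m invmx g.
Proof.
move=> hg hh; have [ug uh] := (mx2_det1_unit hg, mx2_det1_unit hh).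
have um : g *m h \in unitmx by rewrite unitmx_mul ug.
by rewrite -[RHS]mulmx1 -(mulmxV um) !mulmxA mulmxKV // mulVmx // mul1mx.
Qed.

Lemma invmxN (R : realType) (g : 'M[R]_2) : \det g = 1 ->
  invmx (- g) = - invmx g.
Proof.
rewrite (mx2_eta g) det_mx2 => e.
by rewrite opp_mx2 !invmx_mx2 ?opp_mx2 // -e; ring.
Qed.

(** Cayley-Hamilton in determinant 1. Multiplied by B and traced, it gives tr (A^-1 B) = tr A tr B -
    tr (A B). *)
Lemma invmx_tr (R : realType) (g : 'M[R]_2) : \det g = 1 ->
  invmx g = (\tr g)%:M - g.
Proof.
rewrite (mx2_eta g) det_mx2 mxtrace_mx2 -scalemx1 one_mx2 => e.
by rewrite invmx_mx2 // scale_mx2 opp_mx2 add_mx2; congr mx2; ring.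
Qed.

(** * The Moebius action as conjugation of matrices *)

(* Points of the hyperbolic plane as the elliptic elements of order 4 fixing
   them: [tr (N * Jmx z)] is then affine in z in the projective model, and the
   action of SL_2 becomes conjugation. *)
Definition Jmx (R : realType) (z : R * R) : 'M[R]_2 :=
  mx2 (z.1 / z.2) (- ((z.1 ^+ 2 + z.2 ^+ 2) / z.2)) (1 / z.2) (- (z.1 / z.2)).

Lemma Jmx_inj (R : realType) (z w : R * R) :
  0 < z.2 -> 0 < w.2 -> Jmx z = Jmx w -> z = w.
Proof.
case: z w => [x y] [x' y'] /= hy hy' /mx2_inj /= [e1 _ e2 _].
have ey : y = y'.
  by move: e2; rewrite !mul1r => /(congr1 (@GRing.inv _)); rewrite !invrK.
subst y'; congr (_, _).
have := congr1 ( *%R^~ y) e1; rewrite !mulfVK //; exact: lt0r_neq0.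
Qed.

Lemma mobius_mx2 (R : realType) (a b c d x y : R) :
  mobius (mx2 a b c d) (x, y) =
  (((a * x + b) * (c * x + d) + a * c * y ^+ 2) /
     ((c * x + d) ^+ 2 + (c * y) ^+ 2),
   y / ((c * x + d) ^+ 2 + (c * y) ^+ 2)).
Proof. by rewrite /mobius !mxE. Qed.

Lemma mobius_den_gt0 (R : realType) (a b c d x y : R) :
  a * d - b * c = 1 -> 0 < y -> 0 < (c * x + d) ^+ 2 + (c * y) ^+ 2.
Proof.
move=> e hy; rewrite lt_neqAle addr_ge0 ?sqr_ge0 // andbT eq_sym.
apply/eqP => h.
have /eqP h1 : (c * y) ^+ 2 == 0.
  by rewrite eq_le sqr_ge0 andbT -h lerDr sqr_ge0.
have /eqP c0 : c == 0.
  by move/eqP: h1; rewrite sqrf_eq0 mulf_eq0 (gt_eqF hy) orbF.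
move: h; rewrite c0 !mul0r add0r expr0n /= addr0 => /eqP.
by rewrite sqrf_eq0 => /eqP d0; move: e; rewrite c0 d0 !mulr0 subr0 => /eqP;
  rewrite eq_sym oner_eq0.
Qed.

Lemma mobius_gt0 (R : realType) (g : 'M[R]_2) z : \det g = 1 -> 0 < z.2 ->
  0 < (mobius g z).2.
Proof.
case: z => x y; rewrite (mx2_eta g) det_mx2 mobius_mx2 /= => e hy.
exact: divr_gt0 hy (mobius_den_gt0 x e hy).
Qed.

(** Once the entries of [Jmx (mobius g z)] are simplified, the entries of the two products agree up
    to a factor a d - b c. Keeping [g] on both sides avoids its inverse. *)
Lemma Jmx_mobius (R : realType) (g : 'M[R]_2) z : \det g = 1 -> 0 < z.2 ->
  Jmx (mobius g z) *m g = g *m Jmx z.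
Proof.
case: z => x y.
rewrite (mx2_eta g); move: (g ord0 ord0) (g ord0 ord_max) (g ord_max ord0)
  (g ord_max ord_max) => a b c d.
rewrite det_mx2 mobius_mx2 /Jmx /= => e hy.
have hden := mobius_den_gt0 x e hy.
set D := (c * x + d) ^+ 2 + (c * y) ^+ 2 in hden *.
have D0 : D != 0 by rewrite gt_eqF.
have y0 : y != 0 by rewrite gt_eqF.
set p := (a * x + b) * (c * x + d) + a * c * y ^+ 2.
(* |az + b|^2 |cz + d|^2 = |(az + b)(conj (cz + d))|^2 *)
have key : p ^+ 2 + y ^+ 2 = ((a * x + b) ^+ 2 + (a * y) ^+ 2) * D.
  transitivity (p ^+ 2 + (a * d - b * c) ^+ 2 * y ^+ 2).
    by rewrite e expr1n mul1r.
  by rewrite /p /D; ring.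
have -> : ((p / D) ^+ 2 + (y / D) ^+ 2) / (y / D) =
  ((a * x + b) ^+ 2 + (a * y) ^+ 2) / y.
  transitivity ((p ^+ 2 + y ^+ 2) / (D * y)); first by field; rewrite D0 y0.
  by rewrite key; field; rewrite D0 y0.
have -> : p / D / (y / D) = p / y by field; rewrite D0 y0.
have -> : 1 / (y / D) = D / y by field; rewrite D0 y0.
rewrite !mul_mx2; congr mx2; rewrite /p /D.
- transitivity ((a * d - b * c) * (a * x + b) / y); first by field.
  by rewrite e; field.
- transitivity (- (a * d - b * c) * ((a * x + b) * x + a * y ^+ 2) / y).
    by field.
  by rewrite e; field.
- transitivity ((a * d - b * c) * (c * x + d) / y); first by field.
  by rewrite e; field.
- transitivity (- (a * d - b * c) * ((c * x + d) * x + c * y ^+ 2) / y).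
    by field.
  by rewrite e; field.
Qed.

Lemma Jmx_mobius_conj (R : realType) (g : 'M[R]_2) z : \det g = 1 -> 0 < z.2 ->
  Jmx (mobius g z) = g *m Jmx z *m invmx g.
Proof.
by move=> hg hz; rewrite -Jmx_mobius // mulmxK // mx2_det1_unit.
Qed.

(** [Jmx] is injective and turns the action into conjugation, so the composition law reduces to
    associativity of the matrix product. *)
Lemma mobius_comp (R : realType) (g h : 'M[R]_2) z :
  \det g = 1 -> \det h = 1 -> 0 < z.2 ->
  mobius (g *m h) z = mobius g (mobius h z).
Proof.
move=> hg hh hz; apply: Jmx_inj; rewrite ?mobius_gt0 // ?det1M //.
have u : g *m h \in unitmx by rewrite mx2_det1_unit ?det1M.
have gh := mobius_gt0 hh hz.
apply: (can_inj (mulmxK u)); rewrite Jmx_mobius ?det1M //.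
by rewrite mulmxA Jmx_mobius // -!mulmxA Jmx_mobius.
Qed.

Lemma mobius1 (R : realType) (z : R * R) : mobius 1%:M z = z.
Proof.
case: z => x y; rewrite one_mx2 mobius_mx2.
have -> : (0 * x + 1) ^+ 2 + (0 * y) ^+ 2 = 1 :> R by ring.
by rewrite !divr1; congr (_, _); ring.
Qed.

Lemma mobiusN (R : realType) (g : 'M[R]_2) z : mobius (- g) z = mobius g z.
Proof.
case: z => x y; rewrite (mx2_eta g) opp_mx2 !mobius_mx2.
by congr (_ / _, _ / _); ring.
Qed.

Lemma mobiusK (R : realType) (g : 'M[R]_2) z : \det g = 1 -> 0 < z.2 ->
  mobius (invmx g) (mobius g z) = z.
Proof.
move=> hg hz; rewrite -mobius_comp ?det1V // mulVmx ?mobius1 //.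
exact: mx2_det1_unit.
Qed.

Lemma mobiusVK (R : realType) (g : 'M[R]_2) z : \det g = 1 -> 0 < z.2 ->
  mobius g (mobius (invmx g) z) = z.
Proof.
move=> hg hz; rewrite -mobius_comp ?det1V // mulmxV ?mobius1 //.
exact: mx2_det1_unit.
Qed.

(** Fixing z means commuting with [Jmx z], that is, a - d = 2 c x and - b = c (x^2 + y^2). If c is
    nonzero these equations determine z, so two fixed points force c = 0 and [g] is scalar. *)
Lemma mobius_fix2 (R : realType) (g : 'M[R]_2) z w : \det g = 1 ->
  0 < z.2 -> 0 < w.2 -> z <> w -> mobius g z = z -> mobius g w = w ->
  g = 1%:M \/ g = - 1%:M.
Proof.
case: z w => [x y] [x' y'] /= hg hy hy' hzw.
move=> /(congr1 (fun u => Jmx u *m g)); rewrite Jmx_mobius //.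
move=> e1 /(congr1 (fun u => Jmx u *m g)); rewrite Jmx_mobius //.
move: hg e1; rewrite (mx2_eta g); move: (g ord0 ord0) (g ord0 ord_max)
  (g ord_max ord0) (g ord_max ord_max) => a b c d.
have fixE x0 y0 : 0 < y0 ->
    mx2 a b c d *m Jmx (x0, y0) = Jmx (x0, y0) *m mx2 a b c d ->
    a - d = c * (2 * x0) /\ - b = c * (x0 ^+ 2 + y0 ^+ 2).
  move=> hy0; rewrite !mul_mx2 /= => /mx2_inj [e1 _ e3 _].
  have y00 : y0 != 0 by rewrite gt_eqF.
  have := congr1 ( *%R^~ y0) e1; have := congr1 ( *%R^~ y0) e3.
  have -> : (c * (x0 / y0) + d * (1 / y0)) * y0 = c * x0 + d by field.
  have -> : (1 / y0 * a + - (x0 / y0) * c) * y0 = a - x0 * c by field.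
  have -> : (a * (x0 / y0) + b * (1 / y0)) * y0 = a * x0 + b by field.
  have -> : (x0 / y0 * a + - ((x0 ^+ 2 + y0 ^+ 2) / y0) * c) * y0 =
    x0 * a - c * (x0 ^+ 2 + y0 ^+ 2) by field.
  by move=> f1 f2; split; lra.
rewrite det_mx2 => e /(fixE _ _ hy) [e1 e2] /(fixE _ _ hy') [e3 e4].
have c0 : c = 0.
  apply/eqP; apply/negPn/negP => c0; apply: hzw.
  have ex : x = x'.
    by apply: (mulIf (_ : 2 != 0)) => //; apply: (mulfI c0); lra.
  congr (_, _) => //; apply/eqP; rewrite -(eqrXn2 (_ : 0 < 2)%N) ?ltW //.
  apply/eqP; apply: (mulfI c0); move: e2 e4; rewrite ex; lra.
rewrite c0 !mul0r in e1 e2.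
have ed : d = a by lra.
have b0 : b = 0 by lra.
move: e; rewrite ed c0 b0 mul0r subr0 -expr2 => /eqP.
rewrite sqrf_eq1 => /orP [] /eqP ->; [left | right]; rewrite one_mx2 //.
by rewrite opp_mx2 oppr0.
Qed.

Lemma mobius_cont (R : realType) (g : 'M[R]_2) (z : R * R) : \det g = 1 ->
  0 < z.2 -> {for z, continuous (mobius g)}.
Proof.
case: z => x y hg /= hy; rewrite /continuous_at (mx2_eta g); move: hg.
rewrite {1}(mx2_eta g); move: (g ord0 ord0) (g ord0 ord_max)
  (g ord_max ord0) (g ord_max ord_max) => a b c d; rewrite det_mx2 => e.
have hden := mobius_den_gt0 x e hy.
have -> : mobius (mx2 a b c d) = fun z : R * R =>
    (((a * z.1 + b) * (c * z.1 + d) + a * c * (z.2 * z.2)) /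
     ((c * z.1 + d) * (c * z.1 + d) + (c * z.2) * (c * z.2)),
     z.2 / ((c * z.1 + d) * (c * z.1 + d) + (c * z.2) * (c * z.2))).
  by apply/funext => -[u v]; rewrite mobius_mx2 -!expr2.
have cx : (z.1 @[z --> ((x, y) : R * R)]) --> x by exact: cvg_fst.
have cy : (z.2 @[z --> ((x, y) : R * R)]) --> y by exact: cvg_snd.
have lin p q : (p * z.1 + q @[z --> ((x, y) : R * R)]) --> p * x + q.
  by apply: cvgD; [apply: cvgM => //; exact: cvg_cst | exact: cvg_cst].
have liny p : (p * z.2 @[z --> ((x, y) : R * R)]) --> p * y.
  by apply: cvgM => //; exact: cvg_cst.
have den : (((c * z.1 + d) * (c * z.1 + d) + (c * z.2) * (c * z.2))^-1
    @[z --> ((x, y) : R * R)]) -->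
    ((c * x + d) * (c * x + d) + (c * y) * (c * y))^-1.
  apply: cvgV; first by rewrite -!expr2 gt_eqF.
  by apply: cvgD; apply: cvgM.
have num : ((a * z.1 + b) * (c * z.1 + d) + a * c * (z.2 * z.2)
    @[z --> ((x, y) : R * R)]) -->
    (a * x + b) * (c * x + d) + a * c * (y * y).
  apply: cvgD; first exact: cvgM.
  by apply: cvgM; [exact: cvg_cst | exact: cvgM].
exact: cvg_pair (cvgM num den) (cvgM cy den).
Qed.

(** * Hyperbolic cosine and distance *)

Lemma coshR_norm (R : realType) (x : R) : coshR `|x| = coshR x.
Proof. by case: (ger0P x) => // _; rewrite /coshR opprK addrC. Qed.

Lemma coshR_ge1 (R : realType) (x : R) : 1 <= coshR x.
Proof.
rewrite /coshR expRN; have e0 := expR_gt0 x.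
rewrite -subr_ge0.
have -> : (expR x + (expR x)^-1) / 2 - 1 = (expR x - 1) ^+ 2 / (2 * expR x).
  by field; rewrite gt_eqF.
by rewrite divr_ge0 ?sqr_ge0 // mulr_ge0 // ltW.
Qed.

Lemma coshR_lt (R : realType) (x y : R) : 0 <= x -> x < y -> coshR x < coshR y.
Proof.
move=> x0 xy; rewrite /coshR !expRN -subr_gt0.
have ex := expR_gt0 x; have ey := expR_gt0 y.
have -> : (expR y + (expR y)^-1) / 2 - (expR x + (expR x)^-1) / 2 =
  (expR y - expR x) * (expR x * expR y - 1) / (2 * (expR x * expR y)).
  by field; rewrite !gt_eqF.
have h : expR x < expR y by rewrite ltr_expR.
have h1 : 1 <= expR x by rewrite -expR0 ler_expR.
apply: divr_gt0; last by rewrite !mulr_gt0.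
apply: mulr_gt0; first by rewrite subr_gt0.
rewrite subr_gt0; apply: (lt_le_trans (le_lt_trans h1 h)).
by rewrite ler_peMl // ltW.
Qed.

Lemma ler_coshR (R : realType) (x y : R) :
  (coshR x <= coshR y) = (`|x| <= `|y|).
Proof.
rewrite -(coshR_norm x) -(coshR_norm y).
have [h | h] := leP `|x| `|y|; last by apply/negbTE; rewrite -ltNge coshR_lt.
by move: h; rewrite le_eqVlt => /orP [/eqP -> | h];
  rewrite ?lexx ?ltW ?coshR_lt.
Qed.

Lemma ltr_coshR (R : realType) (x y : R) :
  (coshR x < coshR y) = (`|x| < `|y|).
Proof. by rewrite !ltNge ler_coshR. Qed.

Lemma arcoshRK (R : realType) (x : R) : 1 <= x -> coshR (arcoshR x) = x.
Proof.
move=> x1; rewrite /arcoshR; set r := Num.sqrt _.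
have r0 : 0 <= r by exact: sqrtr_ge0.
have r2 : r ^+ 2 = x ^+ 2 - 1 by rewrite sqr_sqrtr // subr_ge0; nra.
have p : 0 < x + r by lra.
rewrite /coshR expRN lnK //.
have -> : (x + r)^-1 = x - r.
  apply: (mulfI (lt0r_neq0 p)); rewrite divff ?gt_eqF //.
  by transitivity (x ^+ 2 - r ^+ 2); [rewrite r2; ring | ring].
by field.
Qed.

Lemma coshRK (R : realType) (x : R) : arcoshR (coshR x) = `|x|.
Proof.
have : coshR (arcoshR (coshR x)) = coshR x by rewrite arcoshRK ?coshR_ge1.
move=> e; have : `|arcoshR (coshR x)| = `|x|.
  by apply/eqP; rewrite eq_le -!ler_coshR e lexx.
rewrite ger0_norm // /arcoshR ln_ge0 //.
by rewrite (le_trans (coshR_ge1 x)) // lerDl sqrtr_ge0.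
Qed.

(** The trace pairing of two matrices [Jmx] is -2 cosh of the distance, as in the hyperboloid model.
    The absolute value accommodates signed parameters on a geodesic. *)
Lemma hdistP (R : realType) (z w : R * R) (t : R) : 0 < z.2 -> 0 < w.2 ->
  (hdist z w = `|t| <-> \tr (Jmx z *m Jmx w) = - 2 * coshR t).
Proof.
case: z w => [x y] [x' y'] /= hy hy'.
set c := 1 + ((x - x') ^+ 2 + (y - y') ^+ 2) / (2 * y * y').
have -> : \tr (Jmx (x, y) *m Jmx (x', y')) = - 2 * c.
  by rewrite /Jmx mul_mx2 mxtrace_mx2 /c /=; field; rewrite !gt_eqF.
have c1 : 1 <= c.
  by rewrite lerDl divr_ge0 ?addr_ge0 ?sqr_ge0 // !mulr_ge0 // ltW.
rewrite /hdist /= -/c; split => [h | h].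
  by rewrite -[in RHS]coshR_norm -h arcoshRK.
have -> : c = coshR t by lra.
exact: coshRK.
Qed.

(** * Geodesic lines as images of the imaginary axis *)

Lemma geodesic_lineP (R : realType) (s : R -> R * R) :
  geodesic_line s <-> (forall t, 0 < (s t).2) /\
    forall t u, \tr (Jmx (s t) *m Jmx (s u)) = - 2 * coshR (t - u).
Proof.
by split=> -[h1 h2]; split => // t u; apply/hdistP => //; apply: h1.
Qed.

Lemma tr_Jmx_mobius (R : realType) (g : 'M[R]_2) z w : \det g = 1 ->
  0 < z.2 -> 0 < w.2 ->
  \tr (Jmx (mobius g z) *m Jmx (mobius g w)) = \tr (Jmx z *m Jmx w).
Proof.
move=> hg hz hw; rewrite !Jmx_mobius_conj //.
have u := mx2_det1_unit hg.
rewrite -!mulmxA (mulmxA (invmx g)) mulVmx // mul1mx mxtrace_mulC.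
by rewrite !mulmxA mulmxKV.
Qed.

Lemma tr_Jmx_axis (R : realType) (x y E : R) : 0 < y -> 0 < E ->
  \tr (Jmx (x, y) *m Jmx (0, E)) = - (x ^+ 2 + y ^+ 2 + E ^+ 2) / (y * E).
Proof.
move=> hy hE; rewrite /Jmx mul_mx2 mxtrace_mx2 /=.
by field; rewrite !gt_eqF.
Qed.

Lemma axis_geodesic (R : realType) (k : 'M[R]_2) : \det k = 1 ->
  geodesic_line (fun u => mobius k (0, expR u)).
Proof.
move=> hk; apply/geodesic_lineP; split=> [t | t u].
  by rewrite mobius_gt0 //= expR_gt0.
rewrite tr_Jmx_mobius ?expR_gt0 // tr_Jmx_axis ?expR_gt0 // /coshR.
rewrite opprB !expRB; have := expR_gt0 t; have := expR_gt0 u => h1 h2.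
by field; rewrite !gt_eqF.
Qed.

(** The hyperbolic translation by L along the imaginary axis. The entries carry L / 2 because the
    action depends on their ratio. *)
Definition diagmx (R : realType) (L : R) : 'M[R]_2 :=
  mx2 (expR (L / 2)) 0 0 (expR (- (L / 2))).

Lemma det_diagmx (R : realType) (L : R) : \det (diagmx L) = 1.
Proof. by rewrite det_mx2 mulr0 subr0 -expRD subrr expR0. Qed.

Lemma mobius_diagmx (R : realType) (L E : R) :
  mobius (diagmx L) (0, E) = (0, expR L * E).
Proof.
rewrite mobius_mx2.
have e0 : expR (- (L / 2)) != 0 by rewrite gt_eqF ?expR_gt0.
congr (_, _); first by field.
have -> : expR L = expR (L / 2) * expR (L / 2) by rewrite -expRD -splitr.
have -> : expR (L / 2) = (expR (- (L / 2)))^-1 by rewrite -expRN opprK.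
by field.
Qed.

(** The half-turn about i, which reverses the imaginary axis and exchanges its two sides. *)
Definition flipmx (R : realType) : 'M[R]_2 := mx2 0 (-1) 1 0.

Lemma det_flipmx (R : realType) : \det (flipmx R) = 1.
Proof. by rewrite det_mx2; ring. Qed.

Lemma mobius_flipmx (R : realType) (E : R) : 0 < E ->
  mobius (flipmx R) (0, E) = (0, E^-1).
Proof.
by move=> hE; rewrite mobius_mx2; congr (_, _); field; rewrite gt_eqF.
Qed.

(** Two points not on a vertical line lie on a half-circle of radius r centred at a point c of the
    real line. The frame sends 0 to c - r and infinity to c + r; m = sqrt (2 r) normalises its
    determinant. *)
Lemma common_axis (R : realType) (z w : R * R) : 0 < z.2 -> 0 < w.2 ->
  exists k E F, [/\ \det k = 1, 0 < E, 0 < F, z = mobius k (0, E) &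
    w = mobius k (0, F)].
Proof.
case: z w => [x y] [x' y'] /= hy hy'.
have [exx | nx] := eqVneq x x'.
  exists (mx2 1 x 0 1), y, y'; split=> //; first by rewrite det_mx2; ring.
    by rewrite mobius_mx2; congr (_, _); field.
  by rewrite -exx mobius_mx2; congr (_, _); field.
have dx : x' - x != 0 by rewrite subr_eq0 eq_sym.
set c := (x' ^+ 2 + y' ^+ 2 - (x ^+ 2 + y ^+ 2)) / (2 * (x' - x)).
pose r := Num.sqrt ((x - c) ^+ 2 + y ^+ 2).
have p0 : 0 < (x - c) ^+ 2 + y ^+ 2 by rewrite ltr_wpDl ?sqr_ge0 // exprn_gt0.
have r0 : 0 < r by rewrite sqrtr_gt0.
have r1 : r ^+ 2 = (x - c) ^+ 2 + y ^+ 2 by rewrite sqr_sqrtr // ltW.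
have r2 : r ^+ 2 = (x' - c) ^+ 2 + y' ^+ 2.
  by rewrite r1 /c; field.
pose m := Num.sqrt (2 * r).
have m0 : 0 < m by rewrite sqrtr_gt0 mulr_gt0.
have m2 : m ^+ 2 = 2 * r by rewrite sqr_sqrtr // mulr_ge0 // ltW.
have m_inv : (m ^-1) ^+ 2 = (2 * r)^-1 by rewrite exprVn m2.
have pos d e : 0 < e -> r ^+ 2 = d ^+ 2 + e ^+ 2 -> 0 < (r + d) / e.
  move=> e0 rd; apply: divr_gt0 => //.
  have : `|d| < r.
    rewrite -(@ltr_pXn2r _ 2) ?nnegrE ?normr_ge0 ?(ltW r0) //.
    by rewrite real_normK ?num_real // rd ltrDl exprn_gt0.
  by rewrite ltr_norml => /andP[]; lra.
(* The preimage of (c + d, e) on the imaginary axis has as height the ratio of the Euclidean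
   distances from that point to c - r and c + r, which is (r + d) / e. *)
have E d e : 0 < e -> r ^+ 2 = d ^+ 2 + e ^+ 2 ->
  mobius (mx2 ((c + r) / m) ((c - r) / m) (1 / m) (1 / m)) (0, (r + d) / e) =
  (c + d, e).
  move=> e0 rd; have F0 := pos d e e0 rd.
  set F := (r + d) / e in F0 *.
  have q0 : 0 < F ^+ 2 + 1 by rewrite ltr_wpDl ?sqr_ge0.
  rewrite mobius_mx2.
  have -> : (1 / m * 0 + 1 / m) ^+ 2 + (1 / m * F) ^+ 2 =
    (F ^+ 2 + 1) / (2 * r).
    by rewrite -m_inv; ring.
  have FE : (F ^+ 2 + 1) * e ^+ 2 = 2 * r * (r + d).
    have -> : e ^+ 2 = r ^+ 2 - d ^+ 2 by rewrite rd; ring.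
    rewrite /F; transitivity ((r + d) ^+ 2 / e ^+ 2 * (r ^+ 2 - d ^+ 2) +
      (r ^+ 2 - d ^+ 2)); first by field; rewrite gt_eqF.
    have -> : r ^+ 2 - d ^+ 2 = e ^+ 2 by rewrite rd; ring.
    rewrite mulfVK ?expf_neq0 ?gt_eqF //.
    have -> : e ^+ 2 = r ^+ 2 - d ^+ 2 by rewrite rd; ring.
    by ring.
  have rd0 : 0 < r + d by move: F0; rewrite /F pmulr_lgt0 // invr_gt0.
  congr (_, _).
    have -> : ((c + r) / m * 0 + (c - r) / m) * (1 / m * 0 + 1 / m) +
      (c + r) / m * (1 / m) * F ^+ 2 =
      (c * (F ^+ 2 + 1) + r * (F ^+ 2 + 1) - 2 * r) / (2 * r).
      by rewrite -m_inv; ring.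
    apply: (mulIf (lt0r_neq0 (exprn_gt0 2 e0))).
    apply: (mulIf (lt0r_neq0 q0)).
    transitivity (c * ((F ^+ 2 + 1) * e ^+ 2) + r * ((F ^+ 2 + 1) * e ^+ 2)
        - 2 * r * e ^+ 2).
      by field; rewrite !gt_eqF.
    have -> : (c + d) * e ^+ 2 * (F ^+ 2 + 1) =
      (c + d) * ((F ^+ 2 + 1) * e ^+ 2) by ring.
    rewrite FE.
    have -> : e ^+ 2 = r ^+ 2 - d ^+ 2 by rewrite rd; ring.
    by ring.
  apply: (mulIf (lt0r_neq0 (mulr_gt0 q0 e0))).
  transitivity (2 * r * (F * e)); first by field; rewrite !gt_eqF.
  have -> : e * ((F ^+ 2 + 1) * e) = (F ^+ 2 + 1) * e ^+ 2 by ring.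
  by rewrite FE /F mulfVK ?gt_eqF.
exists (mx2 ((c + r) / m) ((c - r) / m) (1 / m) (1 / m)),
  ((r + (x - c)) / y), ((r + (x' - c)) / y'); split.
- rewrite det_mx2; transitivity (m ^-1 ^+ 2 * (2 * r)); first by ring.
  by rewrite m_inv mulVf // gt_eqF // mulr_gt0.
- exact: pos.
- exact: pos.
- by rewrite E //; congr (_, _); ring.
- by rewrite E //; congr (_, _); ring.
Qed.

(** Translating along the common axis puts [z] at i; if [w] then lies below, a half-turn puts it
    above. *)
Lemma line_through (R : realType) (z w : R * R) :
  0 < z.2 -> 0 < w.2 -> z <> w ->
  exists k d, [/\ \det k = 1, 0 < d, z = mobius k (0, 1) &
    w = mobius k (0, expR d)].
Proof.
move=> hz hw zw; have [k [E [F [hk E0 F0 ez ew]]]] := common_axis hz hw.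
have kd := det1M hk (det_diagmx (ln E)).
have [FE | EF | EF] := ltgtP F E; last by case: zw; rewrite ez ew EF.
  exists (k *m diagmx (ln E) *m flipmx R), (ln (E / F)); split.
  - by rewrite det1M ?det_flipmx.
  - by rewrite ln_gt0 // ltr_pdivlMr // mul1r.
  - rewrite mobius_comp ?det_flipmx //= mobius_flipmx // invr1.
    by rewrite mobius_comp ?det_diagmx // mobius_diagmx mulr1 lnK.
  - rewrite lnK ?posrE ?divr_gt0 //.
    rewrite mobius_comp ?det_flipmx //= ?divr_gt0 // mobius_flipmx ?divr_gt0 //.
    rewrite mobius_comp ?det_diagmx //= ?invr_gt0 ?divr_gt0 //.
    rewrite mobius_diagmx lnK //.
    by rewrite invf_div mulrC divfK // gt_eqF.
exists (k *m diagmx (ln E)), (ln (F / E)); split => //.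
- by rewrite ln_gt0 // ltr_pdivlMr // mul1r.
- by rewrite mobius_comp ?det_diagmx // mobius_diagmx mulr1 lnK.
- rewrite lnK ?posrE ?divr_gt0 // mobius_comp ?det_diagmx //= ?divr_gt0 //.
  by rewrite mobius_diagmx lnK // mulrC divfK // gt_eqF.
Qed.

(** In a frame with [s 0] at i and [s 1] at height e, the distances |u| and |u - 1| to these two
    points leave only the point of the axis at height e^u. *)
Lemma geodesic_line_axis (R : realType) (s : R -> R * R) : geodesic_line s ->
  exists2 k, \det k = 1 & forall u, s u = mobius k (0, expR u).
Proof.
move/geodesic_lineP => [hs tr_s].
have n2 : - 2 != 0 :> R by rewrite oppr_eq0 pnatr_eq0.
have inj_cosh (d : R) : 0 < d ->
    - 2 * coshR (0 - 1) = - 2 * coshR (0 - d) -> d = 1.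
  move=> d0; rewrite !sub0r => /(mulfI n2) h.
  have : `|- 1| = `|- d|.
    by apply/eqP; rewrite eq_le -!ler_coshR h lexx.
  by rewrite !normrN normr1 gtr0_norm.
have s01 : s 0 <> s 1.
  move=> e; have := tr_s 0 1; have := tr_s 0 0; rewrite -e => -> /(mulfI n2) h.
  have : `|0 - 0 : R| = `|0 - 1 : R|.
    by apply/eqP; rewrite eq_le -!ler_coshR h lexx.
  by rewrite subrr sub0r normrN normr1 normr0 => /eqP; rewrite eq_sym oner_eq0.
have [k [d [hk d0 e0 e1]]] := line_through (hs 0) (hs 1) s01.
have [_ tr_k] := (geodesic_lineP _).1 (axis_geodesic hk).
have d1 : d = 1.
  by apply: inj_cosh => //; rewrite -tr_s -tr_k expR0 -e0 -e1.
exists k => // u; move: (hs u); set z := s u => hz.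
have hV := det1V hk; have hz' := mobius_gt0 hV hz.
suff : mobius (invmx k) z = (0, expR u).
  by move=> <-; rewrite mobiusVK.
have key v : (v = 0) \/ (v = 1) ->
  \tr (Jmx (mobius (invmx k) z) *m Jmx (0, expR v)) = - 2 * coshR (u - v).
  move=> hv; rewrite -(mobiusK (z := (0, expR v)) hk) /= ?expR_gt0 //.
  rewrite tr_Jmx_mobius ?mobius_gt0 ?expR_gt0 // -/z -tr_s.
  by congr (\tr (_ *m Jmx _)); case: hv => ->; rewrite ?expR0 ?e0 // e1 d1.
move: (key 0 (or_introl erefl)) (key 1 (or_intror erefl)) hz' => {key}.
case: (mobius (invmx k) z) => x y /= k0 k1 hy; move: k0 k1.
rewrite !tr_Jmx_axis ?expR_gt0 // expR0 /coshR !expRN !expRB expR0 divr1.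
have U := expR_gt0 u; set eu := expR u in U *.
have eE : 1 < expR 1 :> R by rewrite expR_gt1.
set e := expR 1 in eE *; have e0' : 0 < e by rewrite (lt_trans _ eE).
move=> k0 k1.
(* The two distance conditions without denominators. Their difference gives y = e^u, and the first
   one then gives x = 0. *)
have f0 : x ^+ 2 + y ^+ 2 + 1 = y * (eu + eu^-1).
  transitivity (- (- (x ^+ 2 + y ^+ 2 + 1 ^+ 2) / (y * 1)) * y).
    by field; rewrite gt_eqF.
  by rewrite k0; field; rewrite gt_eqF.
have f1 : x ^+ 2 + y ^+ 2 + e ^+ 2 = y * (eu + e ^+ 2 / eu).
  transitivity (- (- (x ^+ 2 + y ^+ 2 + e ^+ 2) / (y * e)) * (y * e)).
    by field; rewrite !gt_eqF.
  by rewrite k1; field; rewrite !gt_eqF.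
have yE : y = eu.
  have q0 : e ^+ 2 - 1 != 0.
    by rewrite gt_eqF // subr_gt0 -(expr1n _ 2) ltr_pXn2r ?nnegrE // ltW.
  apply: (mulIf (_ : (e ^+ 2 - 1) / eu != 0)).
    by rewrite mulf_neq0 // invr_eq0 gt_eqF.
  transitivity ((y * (eu + e ^+ 2 / eu)) - (y * (eu + eu^-1))).
    by field; rewrite gt_eqF.
  by rewrite -f0 -f1; field; rewrite gt_eqF.
congr (_, _) => //; apply/eqP; rewrite -sqrf_eq0.
apply/eqP; transitivity (y * (eu + eu^-1) - y ^+ 2 - 1).
  by rewrite -f0; ring.
by rewrite yE; field; rewrite gt_eqF.
Qed.

Lemma mobius_eq2 (R : realType) (g h : 'M[R]_2) z w : \det g = 1 ->
  \det h = 1 -> 0 < z.2 -> 0 < w.2 -> z <> w -> mobius g z = mobius h z ->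
  mobius g w = mobius h w -> g = h \/ g = - h.
Proof.
move=> hg hh hz hw zw ez ew.
have := @mobius_fix2 _ (invmx h *m g) z w (det1M (det1V hh) hg) hz hw zw.
rewrite !mobius_comp ?det1V // ez ew !mobiusK // => /(_ erefl erefl).
have u := mx2_det1_unit hh.
by case=> /(congr1 (mulmx h)); rewrite mulKVmx // ?mulmxN mulmx1;
  [left | right].
Qed.

(** * Parabolic translations and conjugates *)

Definition transl_mx (R : realType) (e : R) : 'M[R]_2 := mx2 1 e 0 1.

Lemma det_transl_mx (R : realType) (e : R) : \det (transl_mx e) = 1.
Proof. by rewrite det_mx2; ring. Qed.

Lemma mobius_transl_mx (R : realType) (e : R) z :
  mobius (transl_mx e) z = (z.1 + e, z.2).
Proof.
case: z => x y; rewrite mobius_mx2 /=.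
have -> : (0 * x + 1) ^+ 2 + (0 * y) ^+ 2 = 1 :> R by ring.
by rewrite !divr1; congr (_, _); ring.
Qed.

Lemma det_conj1 (R : realType) (k t : 'M[R]_2) : \det k = 1 -> \det t = 1 ->
  \det (k *m t *m invmx k) = 1.
Proof. by move=> hk ht; rewrite !det1M ?det1V. Qed.

Lemma mobius_conj (R : realType) (k t : 'M[R]_2) z : \det k = 1 -> \det t = 1 ->
  0 < z.2 -> mobius (k *m t *m invmx k) (mobius k z) = mobius k (mobius t z).
Proof.
move=> hk ht hz; rewrite mobius_comp ?det1M ?det1V ?mobius_gt0 // mobiusK //.
by rewrite mobius_comp.
Qed.

(** * Convexity and the sides of a boundary geodesic *)

Lemma Jmx_combo_mobius (R : realType) (k : 'M[R]_2) z1 z2 z (l m : R) :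
  \det k = 1 -> 0 < z1.2 -> 0 < z2.2 -> 0 < z.2 ->
  Jmx z = l *: Jmx z1 + m *: Jmx z2 ->
  Jmx (mobius k z) = l *: Jmx (mobius k z1) + m *: Jmx (mobius k z2).
Proof.
move=> hk h1 h2 h e; rewrite !Jmx_mobius_conj // e.
by rewrite mulmxDr mulmxDl -!scalemxAr -!scalemxAl.
Qed.

(* A positive combination of [Jmx z1] and [Jmx z2] lies on the geodesic segment
   between z1 and z2. *)
Lemma geodesic_domain_combo (R : realType) (X : set (R * R)) z1 z2 z (l m : R) :
  geodesic_domain X -> X z1 -> X z2 -> 0 < z.2 -> 0 <= l -> 0 <= m ->
  Jmx z = l *: Jmx z1 + m *: Jmx z2 -> X z.
Proof.
move=> hX Xz1 Xz2 hz l0 m0 e.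
have h1 := gd_sub hX Xz1; have h2 := gd_sub hX Xz2.
rewrite /halfplane /= in h1 h2.
have [z12 | z12] := pselect (z1 = z2).
  suff -> : z = z1 by [].
  move: e h1 hz; rewrite -z12 -scalerDl.
  case: (z1) => x1 y1; case: (z) => x y /=.
  rewrite /Jmx scale_mx2 /= => /mx2_inj [e1 e2 e3 _] h1 hz.
  have lm : l + m = y1 / y.
    by move: e3; rewrite !mul1r => ->; field; rewrite gt_eqF.
  have ex : x = x1.
    have := congr1 ( *%R^~ y) e1; rewrite lm /= divfK ?gt_eqF // => ->.
    by field; rewrite !gt_eqF.
  have ey : x ^+ 2 + y ^+ 2 = x1 ^+ 2 + y1 ^+ 2.
    have := congr1 (fun t => - (t * y)) e2; rewrite lm /= mulNr opprK.
    by rewrite divfK ?gt_eqF // => ->; field; rewrite !gt_eqF.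
  congr (_, _) => //; apply/eqP; rewrite -(@eqrXn2 _ 2) ?ltW //.
  by apply/eqP; move: ey; rewrite ex; lra.
have [k [d [hk d0 ez1 ez2]]] := line_through h1 h2 z12.
have hV := det1V hk; have hz' := mobius_gt0 hV hz.
have := Jmx_combo_mobius hV h1 h2 hz e.
rewrite ez1 ez2 !mobiusK ?expR_gt0 //.
move: hz' (mobiusVK hk hz); case: (mobius (invmx k) z) => x y /= hy <-.
have E1 : 1 < expR d by rewrite expR_gt1.
rewrite /Jmx !scale_mx2 add_mx2 /= => /mx2_inj [e1 e2 e3 _].
have x0 : x = 0.
  have := congr1 ( *%R^~ y) e1; rewrite /= divfK ?gt_eqF // => ->.
  by rewrite !mul0r !mulr0 addr0 mul0r.
have E0 : 0 < expR d by rewrite expR_gt0.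
set E := expR d in E0 E1 e1 e2 e3.
(* In the frame with z1 = i and z2 = E i, the remaining entries give y = l + m E and y (l + m / E) =
   1; together they force 1 <= y <= E. *)
have f2 : y = l + m * E.
  have := congr1 -%R e2; rewrite opprK x0 => f.
  transitivity ((0 ^+ 2 + y ^+ 2) / y); first by field; rewrite gt_eqF.
  by rewrite f; field; rewrite gt_eqF.
have f3 : y * (l + m / E) = 1.
  transitivity (y * (1 / y)); last by field; rewrite gt_eqF.
  by rewrite e3; field; rewrite gt_eqF.
have mE : m / E <= m * E.
  by rewrite ler_pdivrMr // -mulrA ler_peMr //; nra.
have y1 : 1 <= y.
  have ay : l + m / E <= y by rewrite f2 lerD2l.
  rewrite leNgt; apply/negP => y1; nra.
have yE : y <= E.
  have yb : y <= l * E ^+ 2 + m * E by rewrite f2 lerD2r ler_peMr //; nra.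
  have E2 : y * (l * E ^+ 2 + m * E) = E ^+ 2.
    rewrite -[E ^+ 2 in RHS]mul1r -f3; field; by rewrite gt_eqF.
  rewrite leNgt; apply/negP => yE; nra.
have -> : (x, y) = (0, expR (ln y)) by rewrite x0 lnK.
apply: (gd_convex hX (axis_geodesic hk) (t := 0) (v := d)).
- by rewrite expR0 -ez1.
- by rewrite -ez2.
- by rewrite ln_ge0 //= -ler_expR lnK.
Qed.

Lemma near_gt0 (R : realType) (z0 : R * R) (f : R * R -> R) :
  {for z0, continuous f} -> 0 < f z0 -> \forall z \near z0, 0 < f z.
Proof. by move=> cf f0; exact: cvgr_gt cf _ f0. Qed.

Lemma halfplane_near (R : realType) (z0 : R * R) : 0 < z0.2 ->
  \forall z \near z0, 0 < z.2.
Proof. by move=> h; apply: near_gt0 h; exact: cvg_snd. Qed.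

(** In the frame [k], the segments from [z1] to the points of the axis lie in the convex region and
    fill a half-neighbourhood of i on the side of [z1]. *)
Lemma half_side_near (R : realType) (X : set (R * R)) (k : 'M[R]_2) z1 :
  geodesic_domain X -> \det k = 1 ->
  (forall E, 0 < E -> X (mobius k (0, E))) ->
  0 < z1.2 -> X (mobius k z1) -> z1.1 != 0 ->
  \forall z \near ((0, 1) : R * R), 0 <= z.1 / z1.1 -> X (mobius k z).
Proof.
case: z1 => x1 y1 hX hk hE /= h1 Xz1 x10.
(* With q = x / x1 these are 1 - q and the quantity G below: the geodesic from [z1] through z meets
   the axis at height E with E^2 = G / (1 - q). Both equal 1 at i, hence stay positive near it. *)
pose f (z : R * R) := 1 - z.1 / x1.
pose g (z : R * R) := z.1 * z.1 + z.2 * z.2 - z.1 / x1 * (x1 ^+ 2 + y1 ^+ 2).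
have cx : (z.1 @[z --> ((0, 1) : R * R)]) --> (0 : R) by exact: cvg_fst.
have cy : (z.2 @[z --> ((0, 1) : R * R)]) --> (1 : R) by exact: cvg_snd.
have cx1 : (z.1 / x1 @[z --> ((0, 1) : R * R)]) --> 0 / x1.
  by apply: cvgM => //; exact: cvg_cst.
have f_near : \forall z \near ((0, 1) : R * R), 0 < f z.
  apply: near_gt0; last by rewrite /f /= mul0r subr0.
  by apply: cvgB => //; exact: cvg_cst.
have g_near : \forall z \near ((0, 1) : R * R), 0 < g z.
  apply: near_gt0; last by rewrite /g /= !mul0r add0r subr0 mulr1.
  apply: cvgB; first by apply: cvgD; exact: cvgM.
  by apply: cvgM => //; exact: cvg_cst.
have y_near := @halfplane_near R (0, 1) ltr01.
apply: filterS3 f_near g_near y_near => -[x y].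
rewrite /f /g /= => fz gz hy q0 {f g}.
set q := x / x1 in fz gz q0.
have fy : 0 < (1 - q) / y by rewrite divr_gt0.
set G := _ - _ in gz.
have gy : 0 < G / y by rewrite divr_gt0.
pose E := Num.sqrt (G / (1 - q)).
have E0 : 0 < E by rewrite sqrtr_gt0 divr_gt0.
have E2 : E ^+ 2 = G / (1 - q) by rewrite sqr_sqrtr // ltW // divr_gt0.
apply: (@geodesic_domain_combo _ X (mobius k (x1, y1)) (mobius k (0, E)) _
  (q * y1 / y) ((1 - q) / y * E)) => //.
- exact: hE.
- exact: mobius_gt0.
- exact: divr_ge0 (mulr_ge0 q0 (ltW h1)) (ltW hy).
- exact: mulr_ge0 (ltW fy) (ltW E0).
apply: Jmx_combo_mobius => //; rewrite /Jmx !scale_mx2 add_mx2 /=.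
have qE : q * x1 = x by rewrite /q divfK.
have e1 : x / y = q * y1 / y * (x1 / y1) + (1 - q) / y * E * (0 / E).
  by rewrite -qE; field; rewrite !gt_eqF.
congr mx2 => //.
- have -> : (1 - q) / y * E * - ((0 ^+ 2 + E ^+ 2) / E) =
      - ((1 - q) / y * E ^+ 2).
    by field; rewrite !gt_eqF.
  by rewrite E2 /G; field; rewrite !gt_eqF.
- by field; rewrite !gt_eqF.
- by rewrite e1; field; rewrite !gt_eqF.
Qed.

(** Points of the region strictly on both sides of the axis would give two half-neighbourhoods of
    [mobius k (0, 1)], making it an interior point. *)
Lemma boundary_one_side (R : realType) (X : set (R * R)) (k : 'M[R]_2) :
  geodesic_domain X -> \det k = 1 ->
  (forall E, 0 < E -> X (mobius k (0, E))) -> ~ X° (mobius k (0, 1)) ->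
  (forall z, 0 < z.2 -> X (mobius k z) -> 0 <= z.1) \/
  (forall z, 0 < z.2 -> X (mobius k z) -> z.1 <= 0).
Proof.
move=> hX hk hE hI.
have [h | /existsNP [z1 /not_implyP [h1 /not_implyP [Xz1 /negP]]]] :=
  pselect (forall z, 0 < z.2 -> X (mobius k z) -> 0 <= z.1); first by left.
rewrite -ltNge => n1; right => z2 h2 Xz2; rewrite leNgt; apply/negP => n2.
apply: hI; have hV := det1V hk.
have near1 := half_side_near hX hk hE h1 Xz1 (ltr0_neq0 n1).
have near2 := half_side_near hX hk hE h2 Xz2 (lt0r_neq0 n2).
have nearX : \forall z \near ((0, 1) : R * R), X (mobius k z).
  near=> z; have [z0 | z0] := leP 0 z.1.
    have : 0 <= z.1 / z2.1 by rewrite divr_ge0 // ltW.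
    by near: z.
  have : 0 <= z.1 / z1.1 by rewrite -mulrNN -invrN divr_ge0 // oppr_ge0 ltW.
  by near: z.
have h01 : 0 < ((0, 1) : R * R).2 by [].
have h := mobius_gt0 hk h01.
have c : mobius (invmx k) w @[w --> mobius k (0, 1)] -->
  mobius (invmx k) (mobius k (0, 1)) := mobius_cont hV h.
rewrite mobiusK // in c; have nX := c _ nearX; rewrite /interior.
have hn := halfplane_near h.
near=> w.
have hw : 0 < w.2 by near: w.
rewrite -(mobiusVK hk hw).
by near: w; exact: nX.
Unshelve. all: by end_near.
Qed.

(** * Boundary geodesics, cusps and their normal vectors *)

(* lev is a defining function of a boundary component, or of the puncture. *)
Definition geod_end (R : realType) (X : set (R * R)) (lev : R * R -> R)
    (k : 'M[R]_2) : Prop :=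
  [/\ \det k = 1, forall z, 0 < z.2 -> X (mobius k z) -> 0 <= z.1 &
    forall E, 0 < E -> X (mobius k (0, E)) /\ lev (mobius k (0, E)) = 0].

Definition cusp_end (R : realType) (X : set (R * R)) (lev : R * R -> R)
    (k : 'M[R]_2) : Prop :=
  \det k = 1 /\ exists Y, [/\ 0 < Y, forall z, Y < z.2 -> X (mobius k z) &
    forall e, 0 < e ->
      exists Y', forall z, Y < z.2 -> Y' < z.2 -> lev (mobius k z) < e].

(** Disjoint collars of two ends: the form in which the ends being different enters the geometry. *)
Definition far_levels (R : realType) (X : set (R * R))
    (lev lev' : R * R -> R) : Prop :=
  exists2 e, 0 < e & forall z, X z -> lev z < e -> lev' z < e -> False.

Lemma far_levels_sym (R : realType) (X : set (R * R)) (lev lev' : R * R -> R) :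
  far_levels X lev lev' -> far_levels X lev' lev.
Proof. by case=> e e0 h; exists e => // z Xz h1 h2; exact: (h z). Qed.

(** The normal vector of the axis as a traceless matrix: its trace pairing with [Jmx (mobius k z)]
    is 2 x / y, which is nonnegative exactly on the side x >= 0. *)
Definition dual_geod (R : realType) (k : 'M[R]_2) : 'M[R]_2 :=
  k *m mx2 1 0 0 (-1) *m invmx k.

(** The null vector of the ideal point k(oo): its trace pairing with [Jmx (mobius k z)] is 1 / y,
    whose level sets are the horocycles there. *)
Definition dual_cusp (R : realType) (k : 'M[R]_2) : 'M[R]_2 :=
  k *m mx2 0 1 0 0 *m invmx k.

Lemma mxtrace_conj2 (R : realType) (k k' s t : 'M[R]_2) :
  \det k = 1 -> \det k' = 1 ->
  \tr (k *m s *m invmx k *m (k' *m t *m invmx k')) =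
  \tr (s *m ((invmx k *m k') *m t *m invmx (invmx k *m k'))).
Proof.
move=> hk hk'; rewrite invmx_mul ?det1V // invmxK.
by rewrite -!mulmxA mxtrace_mulC !mulmxA.
Qed.

Lemma mobius_rel (R : realType) (k k' : 'M[R]_2) z :
  \det k = 1 -> \det k' = 1 -> 0 < z.2 ->
  mobius k (mobius (invmx k *m k') z) = mobius k' z.
Proof.
move=> hk hk' hz; rewrite mobius_comp ?det1V // mobiusVK //.
exact: mobius_gt0.
Qed.

Lemma mobius_re_sign (R : realType) (a b c d x y : R) :
  a * d - b * c = 1 -> 0 < y -> exists2 D, 0 < D &
  (mobius (mx2 a b c d) (x, y)).1 =
    ((a * x + b) * (c * x + d) + a * c * y ^+ 2) / D.
Proof.
by move=> e hy; rewrite mobius_mx2;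
  exists ((c * x + d) ^+ 2 + (c * y) ^+ 2); rewrite ?(mobius_den_gt0 x e).
Qed.

Lemma mobius_re_ge0 (R : realType) (a b c d x y : R) :
  a * d - b * c = 1 -> 0 < y -> (0 <= (mobius (mx2 a b c d) (x, y)).1) =
    (0 <= (a * x + b) * (c * x + d) + a * c * y ^+ 2).
Proof.
move=> e hy; have [D D0 ->] := mobius_re_sign x e hy.
by rewrite pmulr_lge0 // invr_gt0.
Qed.

Lemma mobius_re_eq0 (R : realType) (a b c d x y : R) :
  a * d - b * c = 1 -> 0 < y ->
  (a * x + b) * (c * x + d) + a * c * y ^+ 2 = 0 ->
  exists2 E, 0 < E & mobius (mx2 a b c d) (x, y) = (0, E).
Proof.
move=> e hy h; have [D D0 e1] := mobius_re_sign x e hy.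
exists (mobius (mx2 a b c d) (x, y)).2.
  by rewrite mobius_gt0 // det_mx2.
by move: e1; case: (mobius _ _) => u v /= ->; rewrite h mul0r.
Qed.

(** Small E isolates [a] and large E isolates [b]; the square roots are explicit values of E at
    which a negative coefficient would win. *)
Lemma affine_ge0 (R : realType) (a b : R) :
  (forall E, 0 < E -> 0 <= a + b * E ^+ 2) -> 0 <= a /\ 0 <= b.
Proof.
move=> h; split; rewrite leNgt; apply/negP => n.
  have b0 : 0 <= `|b| by [].
  pose t := Num.sqrt (- a / (2 * (`|b| + 1))).
  have p : 0 < - a / (2 * (`|b| + 1)) by rewrite divr_gt0; lra.
  have := h t; rewrite sqrtr_gt0 => /(_ p); rewrite sqr_sqrtr ?(ltW p) //.
  set q := - a / _ in p *.
  have e : q * (`|b| + 1) = - a / 2 by rewrite /q; field; lra.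
  have : b * q <= `|b| * q by rewrite ler_pM2r // ler_norm.
  by lra.
have p : 0 < (`|a| + 1) / (- b) by rewrite divr_gt0 ?ltr_wpDl //; lra.
have := h (Num.sqrt ((`|a| + 1) / (- b))); rewrite sqrtr_gt0 => /(_ p).
rewrite sqr_sqrtr ?(ltW p) //.
have -> : b * ((`|a| + 1) / - b) = - (`|a| + 1) by field; lra.
have : a <= `|a| by exact: ler_norm.
by lra.
Qed.

(** If a, b, c, d are the entries of the second frame relative to the first, the trace is 4 a d - 2,
    so the claim is a d <= 0. It comes from each axis lying on the positive side of the other. *)
Lemma geod_geod_pair (R : realType) (X : set (R * R)) lev lev' k k' :
  far_levels X lev lev' -> geod_end X lev k -> geod_end X lev' k' ->
  \tr (dual_geod k *m dual_geod k') <= - 2.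
Proof.
move=> [e e0 far] [hk s1 a1] [hk' s2 a2]; rewrite mxtrace_conj2 //.
have hm : \det (invmx k *m k') = 1 by rewrite det1M ?det1V.
have rel z : 0 < z.2 -> mobius k (mobius (invmx k *m k') z) = mobius k' z.
  by move=> hz; apply: mobius_rel.
have relV z : 0 < z.2 ->
    mobius k' (mobius (invmx (invmx k *m k')) z) = mobius k z.
  by move=> hz; rewrite -rel ?mobius_gt0 ?det1V // mobiusVK.
move: hm rel relV; rewrite (mx2_eta (invmx k *m k')).
move: ((invmx k *m k') ord0 ord0) ((invmx k *m k') ord0 ord_max)
  ((invmx k *m k') ord_max ord0) ((invmx k *m k') ord_max ord_max).
move=> a b c d; rewrite det_mx2 => hm rel relV.
rewrite invmx_mx2 // in relV *.
have hmV : d * a - (- b) * (- c) = 1 by rewrite -hm; ring.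
rewrite !mul_mx2 mxtrace_mx2.
(* The image of i E has a real part with the sign of b d + a c E^2; for the inverse matrix the sign
   is that of - a b - c d E^2. *)
have [bd ac] : 0 <= b * d /\ 0 <= a * c.
  apply: affine_ge0 => E E0.
  have <- : (a * 0 + b) * (c * 0 + d) + a * c * E ^+ 2 = b * d + a * c * E ^+ 2.
    by ring.
  rewrite -mobius_re_ge0 // s1 ?mobius_gt0 ?det_mx2 // rel //.
  by case: (a2 _ E0).
have [ab cd] : 0 <= - (a * b) /\ 0 <= - (c * d).
  apply: affine_ge0 => E E0.
  have <- : (d * 0 + - b) * (- c * 0 + a) + d * - c * E ^+ 2 =
    - (a * b) + - (c * d) * E ^+ 2 by ring.
  rewrite -mobius_re_ge0 // s2 ?mobius_gt0 ?det_mx2 // relV //.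
  by case: (a1 _ E0).
(* If a d > 0, the sign conditions force b = c = 0, so the axes coincide and one point has level 0
   for both ends. *)
have ad : a * d <= 0.
  rewrite leNgt; apply/negP => ad.
  have b0 : b = 0.
    apply/eqP; rewrite -sqrf_eq0 eq_le sqr_ge0 andbT -(pmulr_rle0 _ ad).
    have := mulr_ge0 bd ab; nra.
  have c0 : c = 0.
    apply/eqP; rewrite -sqrf_eq0 eq_le sqr_ge0 andbT -(pmulr_rle0 _ ad).
    have := mulr_ge0 ac cd; nra.
  have [|E E0 eE] := @mobius_re_eq0 _ a b c d 0 1 hm ltr01.
    by rewrite b0 c0; ring.
  have := rel (0, 1) ltr01; rewrite eE => e1.
  have [Xz l1] := a1 _ E0; have [_ l2] := a2 _ ltr01.
  by apply: (far _ Xz); rewrite ?l1 // e1 l2.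
nra.
Qed.

(** In relative entries the trace is - 2 a c. The horoball lies on the positive side of the axis, so
    a c >= 0, and a c = 0 would make the cusp an endpoint of the axis. *)
Lemma geod_cusp_pair (R : realType) (X : set (R * R)) lev lev' k k' :
  far_levels X lev lev' -> geod_end X lev k -> cusp_end X lev' k' ->
  \tr (dual_geod k *m dual_cusp k') < 0.
Proof.
move=> [e e0 far] [hk s1 a1] [hk' [Y [Y0 XY /(_ e e0) [Y' levY]]]].
rewrite mxtrace_conj2 //.
have hm : \det (invmx k *m k') = 1 by rewrite det1M ?det1V.
have rel z : 0 < z.2 -> mobius k (mobius (invmx k *m k') z) = mobius k' z.
  by move=> hz; apply: mobius_rel.
move: hm rel; rewrite (mx2_eta (invmx k *m k')).
move: ((invmx k *m k') ord0 ord0) ((invmx k *m k') ord0 ord_max)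
  ((invmx k *m k') ord_max ord0) ((invmx k *m k') ord_max ord_max).
move=> a b c d; rewrite det_mx2 => hm rel.
rewrite invmx_mx2 // !mul_mx2 mxtrace_mx2.
suff ac : 0 < a * c by nra.
have ac : 0 <= a * c.
  suff [] : 0 <= b * d + a * c * (Y + 1) ^+ 2 /\ 0 <= a * c by [].
  (* Only heights above Y are in the horoball, so y^2 is written (Y + 1)^2 + E^2 with E free. *)
  apply: affine_ge0 => E E0; set y := Num.sqrt ((Y + 1) ^+ 2 + E ^+ 2).
  have p : (Y + 1) ^+ 2 < (Y + 1) ^+ 2 + E ^+ 2 by rewrite ltrDl exprn_gt0.
  have Yy : Y < y.
    have : Num.sqrt ((Y + 1) ^+ 2) <= y by rewrite ler_wsqrtr // ltW.
    by rewrite sqrtr_sqr ger0_norm; lra.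
  have y0 : 0 < y by rewrite (lt_trans Y0).
  have <- : (a * 0 + b) * (c * 0 + d) + a * c * y ^+ 2 =
      b * d + a * c * (Y + 1) ^+ 2 + a * c * E ^+ 2.
    rewrite sqr_sqrtr; [ring | by rewrite addr_ge0 ?sqr_ge0].
  rewrite -mobius_re_ge0 // s1 ?mobius_gt0 ?det_mx2 // rel //.
  exact: XY.
rewrite lt_neqAle ac andbT eq_sym; apply/eqP => ac0.
(* When a c = 0, some vertical line of the cusp chart is carried into the axis; high enough on it,
   the level of the cusp is below e while that of the axis is 0. *)
have [x hx] : exists x, (a * x + b) * (c * x + d) = 0.
  have [a0 | a0] := eqVneq a 0; last first.
    by exists (- b / a); rewrite mulrC [a * _]mulrC divfK // addNr mulr0.
  have c0 : c != 0.
    by apply/eqP => c0; move: hm; rewrite a0 c0 !mul0r mulr0 subr0 => /eqP;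
      rewrite eq_sym oner_eq0.
  by exists (- d / c); rewrite [c * _]mulrC divfK // addNr mulr0.
set y := Num.max Y Y' + 1.
have My t : t <= Num.max Y Y' -> t < y.
  by move=> h; rewrite (le_lt_trans h) // ltrDl ltr01.
have Yy : Y < y by apply: My; rewrite le_max lexx.
have Yy' : Y' < y by apply: My; rewrite le_max lexx orbT.
have y0 : 0 < y by rewrite (lt_trans Y0).
have [|E E0 eE] := @mobius_re_eq0 _ a b c d x y hm y0.
  by rewrite hx ac0; ring.
have := rel (x, y) y0; rewrite eE => e1.
have [Xz l1] := a1 _ E0.
by apply: (far _ Xz); rewrite ?l1 // e1 levY.
Qed.

(** In relative entries the trace is - c^2. If c = 0, both cusps sit at the same ideal point, and a
    point high enough in one horoball is high in the other. *)
Lemma cusp_cusp_pair (R : realType) (X : set (R * R)) lev lev' k k' :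
  far_levels X lev lev' -> cusp_end X lev k -> cusp_end X lev' k' ->
  \tr (dual_cusp k *m dual_cusp k') < 0.
Proof.
move=> [e e0 far] [hk [Y1 [Y10 XY1 /(_ e e0) [Y1' levY1]]]].
move=> [hk' [Y [Y0 XY /(_ e e0) [Y' levY]]]].
rewrite mxtrace_conj2 //.
have hm : \det (invmx k *m k') = 1 by rewrite det1M ?det1V.
have rel z : 0 < z.2 -> mobius k (mobius (invmx k *m k') z) = mobius k' z.
  by move=> hz; apply: mobius_rel.
move: hm rel; rewrite (mx2_eta (invmx k *m k')).
move: ((invmx k *m k') ord0 ord0) ((invmx k *m k') ord0 ord_max)
  ((invmx k *m k') ord_max ord0) ((invmx k *m k') ord_max ord_max).
move=> a b c d; rewrite det_mx2 => hm rel.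
rewrite invmx_mx2 // !mul_mx2 mxtrace_mx2.
suff c0 : c != 0.
  have : 0 < c ^+ 2 by rewrite lt_neqAle sqr_ge0 eq_sym sqrf_eq0 c0.
  by nra.
apply/eqP => c0; rewrite c0 mulr0 subr0 in hm.
have d0 : d != 0.
  apply/eqP => d0; move: hm; rewrite d0 mulr0 => /eqP.
  by rewrite eq_sym oner_eq0.
have dd : 0 < d ^+ 2 by rewrite lt_neqAle sqr_ge0 eq_sym sqrf_eq0 d0.
(* A bound on all four thresholds; those of the first cusp are scaled by d^2 because the change of
   frame divides heights by d^2. *)
pose M := Num.max (Num.max Y Y') (Num.max (Y1 * d ^+ 2) (Y1' * d ^+ 2)).
have My t : t <= M -> t < M + 1.
  by move=> h; rewrite (le_lt_trans h) // ltrDl ltr01.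
have y0 : 0 < M + 1 by apply: (lt_trans Y0); apply: My; rewrite !le_max lexx.
have := rel (0, M + 1) y0; rewrite c0 mobius_mx2.
set z := (_ / _, _ / _) => e1.
have z2 : z.2 = (M + 1) / d ^+ 2.
  by rewrite /z /=; congr (_ / _); ring.
apply: (far (mobius k z)).
- apply: XY1; rewrite z2 ltr_pdivlMr //.
  by apply: My; rewrite !le_max lexx ?orbT.
- by apply: levY1; rewrite z2 ltr_pdivlMr //;
    apply: My; rewrite !le_max lexx ?orbT.
- by rewrite e1; apply: levY; apply: My; rewrite !le_max lexx ?orbT.
Qed.

(** * Traces of products of boundary translations *)

(* T is the translation along the boundary component (of length l) or around
   the puncture (l = 0) defined by lev, in the direction given by the sign sg;
   n is the vector N of the header. *)
Definition end_mx (R : realType) (X : set (R * R)) (lev : R * R -> R)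
    (T : 'M[R]_2) (l sg : R) (n : 'M[R]_2) : Prop :=
  (sg = 1 \/ sg = -1) /\
  ((0 < l /\ exists k, [/\ geod_end X lev k, n = dual_geod k &
      T = k *m diagmx (sg * l) *m invmx k]) \/
   (l = 0 /\ exists k, [/\ cusp_end X lev k, n = dual_cusp k &
      T = k *m transl_mx sg *m invmx k])).

(** The coefficient of N in the translation: sinh (l / 2) along a geodesic, and 1 around a cusp,
    where the nilpotent part does not vanish with l. *)
Definition end_speed (R : realType) (l : R) : R :=
  if l == 0 then 1 else (expR (l / 2) - expR (- (l / 2))) / 2.

Lemma end_mx_ge0 (R : realType) X lev T l sg n :
  @end_mx R X lev T l sg n -> 0 <= l.
Proof. by case=> _ [[/ltW] | [->]]. Qed.

Lemma end_speed_gt0 (R : realType) (l : R) : 0 <= l -> 0 < end_speed l.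
Proof.
rewrite /end_speed le_eqVlt eq_sym; case: eqP => //= _ l0.
rewrite divr_gt0 // subr_gt0 ltr_expR; lra.
Qed.

Lemma end_mx_det (R : realType) X lev T l sg n :
  @end_mx R X lev T l sg n -> \det T = 1.
Proof.
by case=> _ [[_ [k [[hk _ _] _ ->]]] | [_ [k [[hk _] _ ->]]]];
  rewrite det_conj1 ?det_diagmx ?det_transl_mx.
Qed.

Lemma end_mxE (R : realType) X lev T l sg n : @end_mx R X lev T l sg n ->
  \tr n = 0 /\ T = coshR (l / 2) *: 1%:M + (sg * end_speed l) *: n.
Proof.
have conj0 (k t : 'M[R]_2) : \det k = 1 -> \tr (k *m t *m invmx k) = \tr t.
  by move=> hk; rewrite mxtrace_mulC mulKmx // mx2_det1_unit.
have conjE (k t : 'M[R]_2) (p q : R) : \det k = 1 ->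
    k *m (p *: 1%:M + q *: t) *m invmx k = p *: 1%:M + q *: (k *m t *m invmx k).
  move=> hk; rewrite mulmxDr mulmxDl -!scalemxAr -!scalemxAl mulmx1 mulmxV //.
  exact: mx2_det1_unit.
case=> hsg [[l0 [k [[hk _ _] -> ->]]] | [-> [k [[hk _] -> ->]]]].
  split; first by rewrite conj0 // mxtrace_mx2 subrr.
  rewrite -conjE //; congr (_ *m _ *m _).
  rewrite one_mx2 !scale_mx2 add_mx2 /end_speed gt_eqF // /coshR /diagmx.
  have eN : -1 * l / 2 = - (l / 2) by ring.
  by case: hsg => ->; rewrite ?eN ?mul1r ?opprK; congr mx2; field.
split; first by rewrite conj0 // mxtrace_mx2 addr0.
rewrite -conjE //; congr (_ *m _ *m _).
rewrite one_mx2 !scale_mx2 add_mx2 /end_speed eqxx mul0r /coshR oppr0 expR0.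
by congr mx2; field.
Qed.

Lemma end_pair (R : realType) X lev T l sg n lev' T' l' sg' n' :
  far_levels X lev lev' -> @end_mx R X lev T l sg n ->
  @end_mx R X lev' T' l' sg' n' ->
  \tr (n *m n') < 0 /\ (0 < l -> 0 < l' -> \tr (n *m n') <= - 2).
Proof.
move=> far [_ [[l0 [k [h -> _]]] | [-> [k [h -> _]]]]].
  move=> [_ [[l0' [k' [h' -> _]]] | [-> [k' [h' -> _]]]]].
    have le := geod_geod_pair far h h'; split => //.
    by rewrite (le_lt_trans le) // oppr_lt0.
  by split; [exact: geod_cusp_pair far h h' | rewrite ltxx].
move=> [_ [[l0' [k' [h' -> _]]] | [-> [k' [h' -> _]]]]].
  split; last by rewrite ltxx.
  by rewrite mxtrace_mulC; exact: geod_cusp_pair (far_levels_sym far) h' h.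
by split; [exact: cusp_cusp_pair far h h' | rewrite ltxx].
Qed.

(** Both normals are traceless, so the trace of the product is 2 cosh (l / 2) cosh (l' / 2) plus a
    signed multiple of their pairing, and the bound -2 leads to the addition formulas. At a cusp the
    sinh terms of these formulas vanish while the pairing stays negative, whence the strict
    inequalities. *)
Lemma end_pair_trace (R : realType) X lev T l sg n lev' T' l' sg' n' :
  far_levels X lev lev' -> @end_mx R X lev T l sg n ->
  @end_mx R X lev' T' l' sg' n' ->
  (sg = sg' /\ \tr (T *m T') <= 2 * coshR ((l - l') / 2) /\
    (l = 0 \/ l' = 0 -> \tr (T *m T') < 2 * coshR ((l - l') / 2))) \/
  (sg = - sg' /\ 2 * coshR ((l + l') / 2) <= \tr (T *m T') /\
    (l = 0 \/ l' = 0 -> 2 * coshR ((l + l') / 2) < \tr (T *m T'))).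
Proof.
move=> far h h'.
have [l0 l0'] := (end_mx_ge0 h, end_mx_ge0 h').
have [t0 t2] := end_pair far h h'.
have [n0 TE] := end_mxE h; have [n0' TE'] := end_mxE h'.
have s0 := end_speed_gt0 l0; have s0' := end_speed_gt0 l0'.
have trE : \tr (T *m T') = 2 * (coshR (l / 2) * coshR (l' / 2)) +
    sg * sg' * (end_speed l * end_speed l' * \tr (n *m n')).
  rewrite TE TE' mulmxDl !mulmxDr -!scalemxAl -!scalemxAr !mul1mx !mulmx1.
  by rewrite !mxtraceD !mxtraceZ n0 n0' mxtrace1; ring.
set t := \tr (n *m n') in t0 t2 trE.
have p0 : end_speed l * end_speed l' * t < 0.
  by rewrite nmulr_llt0 // mulr_gt0.
have [cD cB] : coshR ((l - l') / 2) = coshR (l / 2) * coshR (l' / 2) -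
      (expR (l / 2) - expR (- (l / 2))) / 2 *
      ((expR (l' / 2) - expR (- (l' / 2))) / 2) /\
    coshR ((l + l') / 2) = coshR (l / 2) * coshR (l' / 2) +
      (expR (l / 2) - expR (- (l / 2))) / 2 *
      ((expR (l' / 2) - expR (- (l' / 2))) / 2).
  rewrite /coshR !mulrDl mulNr !opprD !opprK !expRD !expRN.
  by have := expR_gt0 (l / 2); have := expR_gt0 (l' / 2) => e1 e2;
    split; field; rewrite !gt_eqF.
have [le lt] : end_speed l * end_speed l' * t <=
      - 2 * ((expR (l / 2) - expR (- (l / 2))) / 2 *
      ((expR (l' / 2) - expR (- (l' / 2))) / 2)) /\
    (l = 0 \/ l' = 0 -> end_speed l * end_speed l' * t <
      - 2 * ((expR (l / 2) - expR (- (l / 2))) / 2 *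
      ((expR (l' / 2) - expR (- (l' / 2))) / 2))).
  have [e | e] := eqVneq l 0.
    have -> : expR (l / 2) - expR (- (l / 2)) = 0.
      by rewrite e mul0r oppr0 subrr.
    by rewrite !(mul0r, mulr0); split; [exact: ltW | move=> _; exact: p0].
  have [e' | e'] := eqVneq l' 0.
    have -> : expR (l' / 2) - expR (- (l' / 2)) = 0.
      by rewrite e' mul0r oppr0 subrr.
    by rewrite !(mul0r, mulr0); split; [exact: ltW | move=> _; exact: p0].
  split; last by case=> h0; [move: e | move: e']; rewrite h0 eqxx.
  have lp : 0 < l by rewrite lt_neqAle eq_sym e.
  have lp' : 0 < l' by rewrite lt_neqAle eq_sym e'.
  have := t2 lp lp'; move: s0 s0'.
  rewrite /end_speed (negbTE e) (negbTE e') => s0 s0' {}t2.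
  by rewrite [leRHS]mulrC ler_pM2l // mulr_gt0.
case: h h' => hs _ [hs' _].
have ss : sg = sg' /\ sg * sg' = 1 \/ sg = - sg' /\ sg * sg' = - 1.
  by case: hs => ->; case: hs' => ->;
    rewrite ?opprK ?mulrNN ?mulrN ?mulNr ?mul1r; auto.
case: ss => [[ss e] | [ss e]]; rewrite trE e; [left | right].
  by rewrite cD; split=> //; split; [|move=> /lt {}lt]; lra.
by rewrite cB; split=> //; split; [|move=> /lt {}lt]; lra.
Qed.

(** The number of opposite pairs of signs is 0 or 2. If it is 0, the largest length is at most the
    difference of the other two, so one of these is 0; if it is 2, two of the relations add up to a
    length being at most 0. Strictness excludes these zero lengths. *)
Lemma no_coherent_lengths (R : realType) (x y z : R) (s1 s2 s3 : R) :
  0 <= x -> 0 <= y -> 0 <= z -> s1 != 0 ->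
  (s1 = s2 /\ z <= `|x - y| /\ (x = 0 \/ y = 0 -> z < `|x - y|)) \/
  (s1 = - s2 /\ x + y <= z /\ (x = 0 \/ y = 0 -> x + y < z)) ->
  (s1 = s3 /\ y <= `|x - z| /\ (x = 0 \/ z = 0 -> y < `|x - z|)) \/
  (s1 = - s3 /\ x + z <= y /\ (x = 0 \/ z = 0 -> x + z < y)) ->
  (s2 = s3 /\ x <= `|y - z| /\ (y = 0 \/ z = 0 -> x < `|y - z|)) \/
  (s2 = - s3 /\ y + z <= x /\ (y = 0 \/ z = 0 -> y + z < x)) ->
  False.
Proof.
move=> x0 y0 z0 /eqP s0.
have zero (t : R) : 0 <= t -> t = 0 \/ 0 < t.
  by rewrite le_eqVlt => /orP[/eqP <- | ?]; auto.
case=> -[s12 [le12 lt12]] => -[] [s13 [le13 lt13]] => -[] [s23 [le23 lt23]];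
(* An odd number of opposite pairs forces s1 = 0. *)
try (by apply: s0; lra);
(* A vanishing length makes the two comparisons conditioned on it strict; otherwise positivity of
   the lengths is used. *)
(case: (zero x x0) => [ex | x1]; [have q1 := lt12 (or_introl ex);
   have q2 := lt13 (or_introl ex) |
 case: (zero y y0) => [ey | y1]; [have q1 := lt12 (or_intror ey);
   have q2 := lt23 (or_introl ey) |
 case: (zero z z0) => [ez | q2]; [have q1 := lt13 (or_intror ez);
   have q2 := lt23 (or_intror ez) | have q1 := x1]]]);
clear s12 s13 s23 lt12 lt13 lt23 zero; move: le12 le13 le23 q1 q2;
case: (ger0P (x - y)); case: (ger0P (x - z)); case: (ger0P (y - z)); lra.
Qed.

(** If the product is 1, any two of the matrices have a product with the trace of the third, so each
    length is compared with the sum or the difference of the other two. *)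
Lemma end_triple (R : realType) X lev1 lev2 lev3 T1 T2 T3 l1 l2 l3 sg1 sg2 sg3
    n1 n2 n3 :
  far_levels X lev1 lev2 -> far_levels X lev1 lev3 -> far_levels X lev2 lev3 ->
  @end_mx R X lev1 T1 l1 sg1 n1 -> @end_mx R X lev2 T2 l2 sg2 n2 ->
  @end_mx R X lev3 T3 l3 sg3 n3 ->
  T1 *m T2 *m T3 = 1%:M -> False.
Proof.
move=> f12 f13 f23 h1 h2 h3 T123.
have trE lev T l sg n : end_mx X lev T l sg n -> \tr T = 2 * coshR (l / 2).
  move=> /end_mxE [n0 ->]; rewrite mxtraceD !mxtraceZ n0 mxtrace1; ring.
have trV (A B : 'M[R]_2) : \det B = 1 -> A *m B = 1%:M -> \tr A = \tr B.
  move=> hB AB; have u := mx2_det1_unit hB.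
  have -> : A = invmx B by rewrite -[A](mulmxK u) AB mul1mx.
  by rewrite invmx_tr // raddfB /= mxtrace_scalar; ring.
have [d1 d2 d3] := And3 (end_mx_det h1) (end_mx_det h2) (end_mx_det h3).
have e12 : \tr (T1 *m T2) = 2 * coshR (l3 / 2).
  by rewrite -(trE _ _ _ _ _ h3); apply: trV.
have cyc (A B : 'M[R]_2) : A *m B = 1%:M -> B *m A = 1%:M by exact: mulmx1C.
have e23 : \tr (T2 *m T3) = 2 * coshR (l1 / 2).
  rewrite -(trE _ _ _ _ _ h1); apply: trV => //; apply: cyc.
  by rewrite mulmxA.
have e13 : \tr (T1 *m T3) = 2 * coshR (l2 / 2).
  rewrite -(trE _ _ _ _ _ h2) mxtrace_mulC; apply: trV => //.
  by rewrite -mulmxA; apply: cyc.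
have [g1 g2 g3] := And3 (end_mx_ge0 h1) (end_mx_ge0 h2) (end_mx_ge0 h3).
have pairP lev T l sg n lev' T' l' sg' n' l'' : far_levels X lev lev' ->
    end_mx X lev T l sg n -> end_mx X lev' T' l' sg' n' -> 0 <= l'' ->
    \tr (T *m T') = 2 * coshR (l'' / 2) ->
    (sg = sg' /\ l'' <= `|l - l'| /\ (l = 0 \/ l' = 0 -> l'' < `|l - l'|)) \/
    (sg = - sg' /\ l + l' <= l'' /\ (l = 0 \/ l' = 0 -> l + l' < l'')).
  move=> f h h' g'' tE.
  have [g g'] := (end_mx_ge0 h, end_mx_ge0 h').
  have p2 : 0 < 2 :> R by [].
  have i2 : 0 < 2^-1 :> R by rewrite invr_gt0.
  have nl : `|l'' / 2| = l'' * 2^-1 by rewrite ger0_norm // mulr_ge0 // ltW.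
  have ns : `|(l + l') / 2| = (l + l') * 2^-1.
    by rewrite ger0_norm // mulr_ge0 ?addr_ge0 // ltW.
  have nd : `|(l - l') / 2| = `|l - l'| * 2^-1 by rewrite normrM (gtr0_norm i2).
  case: (end_pair_trace f h h') => -[-> []]; rewrite tE.
    rewrite ler_pM2l // ltr_pM2l // ler_coshR ltr_coshR nl nd.
    by rewrite ler_pM2r // ltr_pM2r //; left.
  rewrite ler_pM2l // ltr_pM2l // ler_coshR ltr_coshR nl ns.
  by rewrite ler_pM2r // ltr_pM2r //; right.
have hs : sg1 != 0 by case: h1 => -[] -> _; rewrite ?oppr_eq0 oner_neq0.
exact: (no_coherent_lengths g1 g2 g3 hs
  (pairP _ _ _ _ _ _ _ _ _ _ _ f12 h1 h2 g3 e12)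
  (pairP _ _ _ _ _ _ _ _ _ _ _ f13 h1 h3 g2 e13)
  (pairP _ _ _ _ _ _ _ _ _ _ _ f23 h2 h3 g1 e23)).
Qed.

(** * Continuity on subsets and induction on intervals *)

(** Subspace continuity in terms of ambient neighbourhoods, which makes restriction and gluing into
    filter computations. *)
Definition cts_on (T U : topologicalType) (K : set T) (f : T -> U) : Prop :=
  forall x, K x -> forall V, nbhs (f x) V -> \forall y \near x, K y -> V (f y).

Lemma within_cts_on (T U : topologicalType) (K : set T) (f : T -> U) :
  {within K, continuous f} -> cts_on K f.
Proof. by move/subspace_continuousP => h x Kx V fV; have := h x Kx V fV. Qed.

Lemma cts_on_comp (T U W : topologicalType) (K : set T) (L : set U)
    (f : T -> U) (g : U -> W) :
  cts_on K f -> cts_on L g -> (forall x, K x -> L (f x)) ->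
  cts_on K (g \o f).
Proof.
move=> hf hg KL x Kx V gV; have := hf x Kx _ (hg _ (KL _ Kx) V gV).
by apply: filterS => y h Ky; exact: h Ky (KL _ Ky).
Qed.

Lemma continuous_cts_on (T U : topologicalType) (K : set T) (f : T -> U) :
  (forall x, K x -> {for x, continuous f}) -> cts_on K f.
Proof.
move=> hf x Kx V fV; have n : nbhs x (f @^-1` V) := hf x Kx V fV.
by apply: filterS n => y h _.
Qed.

Lemma cts_on_sub (T U : topologicalType) (K L : set T) (f : T -> U) :
  L `<=` K -> cts_on K f -> cts_on L f.
Proof.
move=> LK hf x Lx V fV; have := hf x (LK _ Lx) V fV.
by apply: filterS => y h Ly; exact: h (LK _ Ly).
Qed.

Lemma cts_on_eq (T U : topologicalType) (K : set T) (f g : T -> U) :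
  (forall x, K x -> f x = g x) -> cts_on K f -> cts_on K g.
Proof.
move=> fg hf x Kx V; rewrite -fg // => fV; have := hf x Kx V fV.
by apply: filterS => y h Ky; rewrite -fg //; exact: h.
Qed.

Lemma cts_on_setU (T U : topologicalType) (K L : set T) (f : T -> U) :
  closed K -> closed L -> cts_on K f -> cts_on L f -> cts_on (K `|` L) f.
Proof.
have half (A : set T) x : closed A -> cts_on A f -> forall V, nbhs (f x) V ->
    \forall y \near x, A y -> V (f y).
  move=> cA hf V fV; have [Ax | nAx] := pselect (A x); first exact: hf.
  have : nbhs x (~` A) by apply: open_nbhs_nbhs; split; [exact: closed_openC |].
  by apply: filterS => y nA /nA.
move=> cK cL hK hL x _ V fV.
apply: filterS2 (half _ x cK hK V fV) (half _ x cL hL V fV) => y h1 h2 [] //.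
Qed.

(** Compactness of the interval as an induction principle: the supremum of the x with [Q a x] is
    attained, and if it were below b the local instance around it would extend past it. *)
Lemma interval_ind (R : realType) (a b : R) (Q : R -> R -> Prop) : a <= b ->
  (forall x, a <= x <= b -> exists2 e, 0 < e & forall u v,
     a <= u -> u <= x -> x <= v -> v <= b -> x - e < u -> v < x + e -> Q u v) ->
  (forall u v w, a <= u -> u <= v -> v <= w -> w <= b ->
     Q u v -> Q v w -> Q u w) ->
  Q a b.
Proof.
move=> ab loc add; pose S := [set x | a <= x <= b /\ Q a x].
have Sa : S a.
  rewrite /S /= lexx ab; split => //.
  have [|e e0 h] := loc a; first by rewrite lexx.
  by apply: h => //; lra.
have ubS : has_ubound S by exists b => x [/andP[]].
have supS : has_sup S by split; [exists a |].
pose c := sup S.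
have ac : a <= c by exact: ub_le_sup.
have cb : c <= b by apply: sup_le_ub; [exists a | move=> x [/andP[]]].
have [|e e0 h] := loc c; first by rewrite ac.
have [x [/andP[ax xb] Qx] cx] := sup_adherent e0 supS.
have xc : x <= c by apply: ub_le_sup => //; split=> //; rewrite ax.
have Q' v : c <= v -> v <= b -> v < c + e -> Q a v.
  move=> cv vb ve; apply: (add a x v) => //; first exact: le_trans xc cv.
  exact: h.
have [bc | cb'] := leP b c.
  have -> : b = c by apply/eqP; rewrite eq_le bc cb.
  by apply: Q' => //; rewrite ltrDl.
pose v := Num.min b (c + e / 2).
have cv : c < v by rewrite lt_min cb' ltrDl divr_gt0.
have vb : v <= b by rewrite ge_min lexx.
have ve : v < c + e by rewrite gt_min ltrD2l; apply/orP; right; lra.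
have : v <= c.
  apply: ub_le_sup => //; split; first by rewrite vb andbT (le_trans ac) // ltW.
  by apply: Q' => //; exact: ltW.
by rewrite leNgt cv.
Qed.

(** * The covering projection *)

Lemma hp_dom_gt0 (R : realType) (P : hyp_pants R) z : hp_dom P z -> 0 < z.2.
Proof. by move=> h; exact: gd_sub (hp_domP P) _ h. Qed.

Lemma hp_grp_eq (R : realType) (P : hyp_pants R) (g h : 'M[R]_2) z :
  hp_grp P g -> hp_grp P h -> hp_dom P z -> mobius g z = mobius h z ->
  g = h \/ g = - h.
Proof.
move=> Gg Gh Xz e; have hz := hp_dom_gt0 Xz.
have dg := hp_grp_det Gg; have dh := hp_grp_det Gh.
have [U xU free] := hp_grp_free Xz.
have GV := hp_grpM (hp_grpV Gh) Gg.
have fixz : mobius (invmx h *m g) z = z.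
  by rewrite mobius_comp ?det1V // e mobiusK.
have Uz : U z by exact: nbhs_singleton.
have u := mx2_det1_unit dh.
by case: (free _ z GV Xz Uz); rewrite ?fixz // => /(congr1 (mulmx h));
  rewrite mulKVmx // ?mulmxN mulmx1; [left | right].
Qed.

(** The preimage of the image is the trace on the domain of the union of the translates of V by the
    group, and this union is open in the half-plane. *)
Lemma hp_proj_open_map (R : realType) (P : hyp_pants R) (V : set (R * R)) :
  open V -> open (@hp_proj R P @` (hp_dom P `&` V)).
Proof.
move=> oV; apply/hp_proj_open.
exists [set z | 0 < z.2 /\ exists2 g, hp_grp P g & V (mobius g z)].
  rewrite openE => z [hz [g Gg Vz]]; rewrite /interior.
  have nV : nbhs (mobius g z) V by exact: open_nbhs_nbhs.
  have c := mobius_cont (hp_grp_det Gg) hz nV.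
  apply: filterS2 (halfplane_near hz) c => w hw Vw; split => //.
  by exists g.
apply/seteqP; split=> z /= [Xz].
  move=> [v [Xv Vv] /esym /(hp_proj_eq Xz Xv) [g Gg e]]; split=> //; split.
    exact: hp_dom_gt0 Xz.
  by exists g => //; rewrite -e.
move=> [hz [g Gg Vz]]; split=> //; exists (mobius g z).
  by split => //; exact: hp_grp_act.
by apply/esym/hp_proj_eq => //; [exact: hp_grp_act | exists g].
Qed.

(** In a neighbourhood U given by freeness, two points with the same projection are equal. A choice
    of preimages in the interior of U is thus forced, and openness of the projection makes it
    continuous. *)
Lemma local_section (R : realType) (P : hyp_pants R) (q : P) :
  exists (s : P -> R * R) (W : set P), [/\ nbhs q W,
    forall q', W q' -> hp_dom P (s q') /\ hp_proj P (s q') = q' & cts_on W s].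
Proof.
have [x Xx <-] := hp_proj_surj q.
have [U xU free] := hp_grp_free Xx.
have oU := open_interior U.
pose W := @hp_proj R P @` (hp_dom P `&` U°).
have /choice [s hs] : forall q', exists z : R * R, W q' ->
    [/\ hp_dom P z, U° z & hp_proj P z = q'].
  move=> q'; have [[z [Xz Uz] e] | n] := pselect (W q'); last by exists x.
  by exists z => _.
exists s, W; split.
- apply: open_nbhs_nbhs; split; first exact: hp_proj_open_map.
  by exists x.
- by move=> q' /hs [].
move=> q' Wq' V; case: (hs _ Wq') => Xs Us e nV.
have : nbhs q' (@hp_proj R P @` (hp_dom P `&` (U° `&` V°))).
  apply: open_nbhs_nbhs; split.
    by apply: hp_proj_open_map; apply: openI => //; exact: open_interior.
  by exists (s q').
apply: filterS => _ [z [Xz [Uz Vz]] <-] /hs [Xs' Us' e'].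
have [g Gg gz] := (hp_proj_eq Xz Xs').1 (esym e').
have [] := free g z Gg Xz (interior_subset Uz); rewrite -?gz.
- exact: interior_subset.
- by move=> g1; rewrite gz g1 mobius1; exact: interior_subset.
- by move=> g1; rewrite gz g1 mobiusN mobius1; exact: interior_subset.
Qed.

Lemma cts_on_mobius (R : realType) (P : hyp_pants R) (T : topologicalType)
    (K : set T) (f : T -> R * R) (g : 'M[R]_2) : \det g = 1 ->
  (forall x, K x -> hp_dom P (f x)) -> cts_on K f -> cts_on K (mobius g \o f).
Proof.
move=> hg Xf hf; apply: (@cts_on_comp _ _ _ K (hp_dom P)) => //.
apply: continuous_cts_on => z Xz; apply: mobius_cont => //.
exact: hp_dom_gt0 Xz.
Qed.

(** * Uniqueness and existence of lifts *)

(** At each parameter the lifts differ by a group element; proper discontinuity makes it locally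
    constant up to sign, and interval induction makes it global. *)
Lemma lift_uniq (R : realType) (P : hyp_pants R) (a b : R) (f h : R -> R * R) :
  a <= b -> cts_on [set t | a <= t <= b] f -> cts_on [set t | a <= t <= b] h ->
  (forall t, a <= t <= b -> [/\ hp_dom P (f t), hp_dom P (h t) &
     hp_proj P (f t) = hp_proj P (h t)]) ->
  exists2 g, hp_grp P g & forall t, a <= t <= b -> h t = mobius g (f t).
Proof.
move=> ab cf ch lf.
pose Q u v := exists2 g, hp_grp P g &
  forall t, u <= t <= v -> h t = mobius g (f t).
suff : Q a b by [].
apply: interval_ind => //.
  move=> x hx; have [Xf Xh e] := lf x hx.
  have [g Gg hg] := (hp_proj_eq Xf Xh).1 e.
  have [U nU free] := hp_grp_free Xh.
  have dg := hp_grp_det Gg.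
  have cg : cts_on [set t | a <= t <= b] (mobius g \o f).
    by apply: (@cts_on_mobius _ P) => // t /lf [].
  have nU' : nbhs ((mobius g \o f) x) U by rewrite /= -hg.
  have : \forall t \near x, a <= t <= b -> h t = mobius g (f t).
    apply: filterS2 (ch x hx U nU) (cg x hx U nU') => t Uh Ug ht.
    have [Xft Xht et] := lf t ht.
    have [g' Gg' hg'] := (hp_proj_eq Xft Xht).1 et.
    have Gr := hp_grpM Gg' (hp_grpV Gg).
    have dg' := hp_grp_det Gg'.
    have hft := hp_dom_gt0 Xft.
    have eq1 : mobius (g' *m invmx g) (mobius g (f t)) = h t.
      by rewrite mobius_comp ?det1V ?mobius_gt0 // mobiusK // hg'.
    have [] := free _ _ Gr (hp_grp_act Gg Xft) (Ug ht); rewrite ?eq1 //.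
    - exact: Uh.
    - by move=> e1; rewrite -eq1 e1 mobius1.
    - by move=> e1; rewrite -eq1 e1 mobiusN mobius1.
  case/nbhs_ballP => e' e0 hb; exists e' => // u v au ux xv vb ue ve.
  exists g => // t /andP[ut tv]; apply: hb.
    by rewrite /ball /= ltr_norml; lra.
  by rewrite (le_trans au ut) (le_trans tv vb).
move=> u v w au uv vw wb [g Gg hg] [g' Gg' hg'].
have hv : a <= v <= b by rewrite (le_trans au uv) (le_trans vw wb).
have [Xv _ _] := lf v hv.
(* The transformations of the two halves agree at [f v], hence up to sign, so one of them serves on
   both. *)
have e : mobius g (f v) = mobius g' (f v).
  by rewrite -hg ?uv ?lexx // -hg' ?lexx.
exists g => // t /andP[ut tw]; have [tv | vt] := leP t v.
  by apply: hg; rewrite ut.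
rewrite hg'; last by rewrite ltW.
by case: (hp_grp_eq Gg Gg' Xv e) => ->; rewrite ?mobiusN.
Qed.

Definition is_lift (R : realType) (P : hyp_pants R) (T : topologicalType)
    (K : set T) (F : T -> P) (h : T -> R * R) : Prop :=
  (forall z, K z -> hp_dom P (h z) /\ hp_proj P (h z) = F z) /\ cts_on K h.

Lemma is_lift_comp (R : realType) (P : hyp_pants R) (T U : topologicalType)
    (K : set T) (L : set U) (F : U -> P) h (f : T -> U) :
  cts_on K f -> (forall x, K x -> L (f x)) -> is_lift L F h ->
  is_lift K (F \o f) (h \o f).
Proof.
move=> hf KL [h1 h2]; split=> [z /KL /h1 // |]; exact: cts_on_comp h2 KL.
Qed.

Lemma is_lift_eq (R : realType) (P : hyp_pants R) (T : topologicalType)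
    (K : set T) (F F' : T -> P) h :
  (forall x, K x -> F x = F' x) -> is_lift K F h -> is_lift K F' h.
Proof.
by move=> e [h1 h2]; split=> // z Kz; rewrite -e //; exact: h1.
Qed.

Lemma is_lift_mobius (R : realType) (P : hyp_pants R) (T : topologicalType)
    (K : set T) (F : T -> P) h g : hp_grp P g -> is_lift K F h ->
  is_lift K F (mobius g \o h).
Proof.
move=> Gg [h1 h2]; have dg := hp_grp_det Gg; split.
  move=> z /h1 [Xh <-]; have Xg := hp_grp_act Gg Xh; split=> //.
  by apply/esym/hp_proj_eq => //; exists g.
by apply: (@cts_on_mobius _ P) => // x /h1 [].
Qed.

Lemma is_lift_uniq (R : realType) (P : hyp_pants R) (a b : R) (F : R -> P) f h :
  a <= b -> is_lift [set t | a <= t <= b] F f ->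
  is_lift [set t | a <= t <= b] F h ->
  exists2 g, hp_grp P g & forall t, a <= t <= b -> h t = mobius g (f t).
Proof.
move=> ab [f1 f2] [h1 h2]; apply: (@lift_uniq _ P) => // t ht.
by case: (f1 t ht) => Xf ->; case: (h1 t ht) => Xh ->.
Qed.

(** Along the common edge the two lifts differ by a single group element; moving the second lift by
    it makes them agree there. *)
Lemma lift_glue (R : realType) (P : hyp_pants R) (K L : set (R * R))
    (edge : R -> R * R) (u v : R) (F : R * R -> P) :
  closed K -> closed L -> u <= v -> continuous edge ->
  (forall t, u <= t <= v -> K (edge t) /\ L (edge t)) ->
  (forall z, K z -> L z -> exists2 t, u <= t <= v & z = edge t) ->
  (exists h, is_lift K F h) -> (exists h, is_lift L F h) ->
  exists h, is_lift (K `|` L) F h.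
Proof.
move=> cK cL uv ce eKL KLe [hK lK] [hL lL].
have ce' : cts_on [set t | u <= t <= v] edge.
  by apply: continuous_cts_on => x _; exact: ce.
have [|||g Gg hg] := @is_lift_uniq _ P u v (F \o edge)
  (hL \o edge) (hK \o edge).
- by [].
- by apply: is_lift_comp lL => // t /eKL [].
- by apply: is_lift_comp lK => // t /eKL [].
have [gL1 gL2] := is_lift_mobius Gg lL.
case: lK => K1 K2.
pose h z := if pselect (K z) then hK z else mobius g (hL z).
have hKE z : K z -> hK z = h z by move=> Kz; rewrite /h; case: pselect.
have hLE z : L z -> (mobius g \o hL) z = h z.
  move=> Lz; rewrite /h; case: pselect => //= Kz.
  by have [t ht ->] := KLe z Kz Lz; rewrite -hg.
exists h; split.
  move=> z [Kz | Lz]; first by rewrite -hKE //; exact: K1.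
  by rewrite -hLE //; exact: gL1.
by apply: cts_on_setU => //; [apply: cts_on_eq K2 | apply: cts_on_eq gL2].
Qed.

Definition rect (R : realType) (a b c d : R) : set (R * R) :=
  [set z | a <= z.1 <= b /\ c <= z.2 <= d].

Lemma closed_rect (R : realType) (a b c d : R) : closed (rect a b c d).
Proof.
have -> : rect a b c d =
    (fst @^-1` `[a, b]%classic) `&` (snd @^-1` `[c, d]%classic).
  by apply/seteqP; split=> z; rewrite /rect /= !in_itv /=.
by apply: closedI; apply: closed_comp; try exact: itv_closed => //;
  move=> z _; [exact: cvg_fst | exact: cvg_snd].
Qed.

(** Local sections lift F on small rectangles. Interval induction in the first coordinate glues them
    into thin horizontal strips, and in the second coordinate stacks the strips. *)
Lemma rect_lift (R : realType) (P : hyp_pants R) (F : R * R -> P) :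
  cts_on (rect 0 1 0 1) F -> exists h, is_lift (rect 0 1 0 1) F h.
Proof.
move=> cF.
have loc z0 : rect 0 1 0 1 z0 -> exists2 e, 0 < e & forall K : set (R * R),
    K `<=` rect 0 1 0 1 -> K `<=` ball z0 e -> exists h, is_lift K F h.
  move=> z01; have [s [W [nW sW cs]]] := local_section (F z0).
  have /nbhs_ballP [e e0 he] := cF z0 z01 W nW.
  exists e => // K K1 Ke; exists (s \o F).
  have KW z : K z -> W (F z) by move=> Kz; apply: he; [exact: Ke | exact: K1].
  split; first by move=> z /KW /sW.
  exact: cts_on_comp (cts_on_sub K1 cF) cs KW.
pose Q u v := exists h, is_lift (rect 0 1 u v) F h.
suff : Q 0 1 by [].
apply: interval_ind; first exact: ler01.
  move=> t ht.
  (* The thickness e of the strip is existential, so that it can shrink when two pieces are glued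
     side by side. *)
  pose Q' a b := exists2 e, 0 < e & forall u v, 0 <= u -> u <= t -> t <= v ->
    v <= 1 -> t - e < u -> v < t + e -> exists h, is_lift (rect a b u v) F h.
  suff : Q' 0 1 by [].
  apply: interval_ind; first exact: ler01.
    move=> s hs; have [|e e0 he] := loc (s, t); first by split.
    exists e => // a b a0 as_ sb b1 ea eb; exists e => // u v u0 ut tv v1 eu ev.
    apply: he => -[x y] [/= /andP[ax xb] /andP[uy yv]].
      by split; rewrite /=; apply/andP; split; lra.
    by split; rewrite /ball /= ltr_norml; apply/andP; split; lra.
  move=> a b c a0 ab bc c1 [e e0 he] [e' e'0 he'].
  exists (Num.min e e'); first by rewrite lt_min e0.
  move=> u v u0 ut tv v1 eu ev.
  have [me me'] : Num.min e e' <= e /\ Num.min e e' <= e'.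
    by rewrite !ge_min !lexx orbT.
  have -> : rect a c u v = rect a b u v `|` rect b c u v.
    apply/seteqP; split=> -[x y]; rewrite /rect /=.
      move=> [/andP[ax xc] hy]; have [xb | bx] := leP x b.
        by left; rewrite ax.
      by right; rewrite ltW.
    by move=> [] [/andP[h1 h2] hy]; split=> //; apply/andP; split; lra.
  apply: (@lift_glue _ P _ _ (fun y => (b, y)) u v).
  - exact: closed_rect.
  - exact: closed_rect.
  - exact: le_trans ut tv.
  - by move=> y; exact: (cvg_pair (cvg_cst _) cvg_id).
  - by move=> y hy; rewrite /rect /= ab bc !lexx.
  - move=> [x y]; rewrite /rect /= => -[/andP[_ xb] hy] [/andP[bx _] _].
    by exists y => //; congr (_, _); apply/eqP; rewrite eq_le xb.
  - by apply: he => //; lra.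
  - by apply: he' => //; lra.
move=> u v w u0 uv vw w1; rewrite /Q => hu hv.
have -> : rect 0 1 u w = rect 0 1 u v `|` rect 0 1 v w.
  apply/seteqP; split=> -[x y]; rewrite /rect /=.
    move=> [hx /andP[uy yw]]; have [yv | vy] := leP y v.
      by left; rewrite uy.
    by right; split=> //; rewrite yw ltW.
  by move=> [] [hx /andP[h1 h2]]; split=> //; apply/andP; split; lra.
apply: (@lift_glue _ P _ _ (fun x => (x, v)) 0 1) => //.
- exact: closed_rect.
- exact: closed_rect.
- by move=> x; exact: (cvg_pair cvg_id (cvg_cst _)).
- by move=> x hx; rewrite /rect /= uv vw !lexx.
- move=> [x y]; rewrite /rect /= => -[hx /andP[_ yv]] [_ /andP[vy _]].
  by exists x => //; congr (_, _); apply/eqP; rewrite eq_le yv.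
Qed.

(** * Monodromy of loops *)

(** The monodromy of [f] at [x]: the deck transformation taking the start of a lift to its end,
    determined up to sign. *)
Definition lifts_to (R : realType) (P : hyp_pants R) (f : R -> P) (x : R * R)
    (g : 'M[R]_2) : Prop :=
  hp_grp P g /\ exists h, [/\ is_lift [set t : R | 0 <= t <= 1] f h, h 0 = x &
    h 1 = mobius g x].

Lemma lifts_to_base (R : realType) (P : hyp_pants R) (f : R -> P) x g :
  lifts_to f x g -> hp_dom P x /\ hp_proj P x = f 0.
Proof.
by case=> _ [h [[h1 _] <- _]]; apply: h1; rewrite /= lexx ler01.
Qed.

Lemma lifts_to_eq (R : realType) (P : hyp_pants R) (f f' : R -> P) x g :
  (forall t, 0 <= t <= 1 -> f t = f' t) -> lifts_to f x g -> lifts_to f' x g.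
Proof.
by move=> e [Gg [h [l h0 h1]]]; split=> //; exists h; split=> //;
  exact: is_lift_eq l.
Qed.

Lemma lifts_to_conj (R : realType) (P : hyp_pants R) (f : R -> P) x g k :
  hp_grp P k -> lifts_to f x g ->
  lifts_to f (mobius k x) (k *m g *m invmx k).
Proof.
move=> Gk fg; have [Xx _] := lifts_to_base fg; case: fg => Gg [h [l h0 h1]].
split; first by apply: hp_grpM; [exact: hp_grpM | exact: hp_grpV].
exists (mobius k \o h); split; first exact: is_lift_mobius.
  by rewrite /= h0.
have dk := hp_grp_det Gk; have dg := hp_grp_det Gg.
by rewrite /= h1 mobius_conj // (hp_dom_gt0 Xx).
Qed.

Lemma lifts_to_uniq (R : realType) (P : hyp_pants R) (f : R -> P) x g g' :
  lifts_to f x g -> lifts_to f x g' -> g = g' \/ g = - g'.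
Proof.
move=> fg; have [Xx _] := lifts_to_base fg; case: fg => Gg [h [l h0 h1]].
case=> Gg' [h' [l' h0' h1']].
have [k Gk hk] := is_lift_uniq ler01 l l'.
have e0 : mobius k x = mobius 1%:M x.
  by rewrite mobius1 -[in LHS]h0 -hk ?h0' // lexx ler01.
have hk1 t : 0 <= t <= 1 -> h' t = h t.
  move=> ht; rewrite hk //.
  by case: (hp_grp_eq Gk (hp_grp1 P) Xx e0) => ->; rewrite ?mobiusN mobius1.
apply: (hp_grp_eq Gg Gg' Xx).
by rewrite -h1 -h1' hk1 // lexx ler01.
Qed.

Lemma lifts_to_opp (R : realType) (P : hyp_pants R) (f : R -> P) x g g' :
  hp_grp P g' -> g = g' \/ g = - g' -> lifts_to f x g -> lifts_to f x g'.
Proof.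
move=> Gg' e [_ [h [l h0 h1]]]; split=> //; exists h; split=> //.
by rewrite h1; case: e => ->; rewrite ?mobiusN.
Qed.

(** The reversed lift starts at g x, so it is moved back by g^-1. *)
Lemma lifts_to_inv (R : realType) (P : hyp_pants R) (f : R -> P) x g :
  lifts_to f x g -> lifts_to (loop_inv f) x (invmx g).
Proof.
move=> fg; have [Xx _] := lifts_to_base fg; case: fg => Gg [h [l h0 h1]].
have GV := hp_grpV Gg.
split => //; exists (mobius (invmx g) \o (h \o (fun t => 1 - t))); split.
- apply: is_lift_mobius => //.
  apply: (@is_lift_comp _ _ _ _ _ [set t : R | 0 <= t <= 1]) l
    => [| t /andP[t0 t1]].
    apply: continuous_cts_on => t _.
    by apply: cvgB; [exact: cvg_cst | exact: cvg_id].
  by rewrite /=; apply/andP; split; lra.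
- by rewrite /= subr0 h1 mobiusK ?(hp_grp_det Gg) // (hp_dom_gt0 Xx).
- by rewrite /= subrr h0.
Qed.

(** The lift of [f'] is moved by [g] to start where that of [f] ends, so monodromies multiply in the
    order of the paths. *)
Lemma lifts_to_mul (R : realType) (P : hyp_pants R) (f f' : R -> P) x g g' :
  lifts_to f x g -> lifts_to f' x g' -> lifts_to (loop_mul f f') x (g *m g').
Proof.
move=> fg fg'; have [Xx fx] := lifts_to_base fg.
have [_ fx'] := lifts_to_base fg'.
case: fg fg' => Gg [h [l h0 h1]] [Gg' [h' [l' h0' h1']]].
split; first exact: hp_grpM.
have := is_lift_mobius Gg l'; set h'' := _ \o h' => l''.
pose k (t : R) := if t <= 2^-1 then h (2 * t) else h'' (2 * t - 1).
have mul2 (t : R) : {for t, continuous (fun t : R => 2 * t)}.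
  by apply: cvgM; [exact: cvg_cst | exact: cvg_id].
have k1 : is_lift [set t : R | 0 <= t <= 2^-1] (f \o (fun t => 2 * t))
    (h \o (fun t => 2 * t)).
  apply: is_lift_comp l; first by apply: continuous_cts_on => t _; exact: mul2.
  by move=> t /= /andP[t0 t1]; apply/andP; split; lra.
have k2 : is_lift [set t : R | 2^-1 <= t <= 1] (f' \o (fun t => 2 * t - 1))
    (h'' \o (fun t => 2 * t - 1)).
  apply: is_lift_comp l''.
    apply: continuous_cts_on => t _.
    by apply: cvgB; [exact: mul2 | exact: cvg_cst].
  by move=> t /= /andP[t0 t1]; apply/andP; split; lra.
have half1 : 2 * 2^-1 = 1 :> R by rewrite divff.
have e1 t : t <= 2^-1 -> (h \o (fun t => 2 * t)) t = k t.
  by move=> ht; rewrite /k ht.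
have e2 t : 2^-1 <= t -> (h'' \o (fun t => 2 * t - 1)) t = k t.
  move=> ht; rewrite /k; case: ifP => //= ht'.
  have -> : t = 2^-1 by apply/eqP; rewrite eq_le ht ht'.
  by rewrite /h'' /= half1 subrr h0' h1.
have cl (a b : R) : closed [set t : R | a <= t <= b].
  have -> : [set t : R | a <= t <= b] = `[a, b]%classic.
    by apply/seteqP; split=> t /=; rewrite in_itv.
  exact: itv_closed.
exists k; split.
- split.
    move=> t /andP[t0 t1]; rewrite /loop_mul; case: ifP => ht.
      by rewrite -e1 //; apply: (proj1 k1); rewrite /= t0.
    have ht' : 2^-1 <= t by rewrite leNgt; apply/negP => /ltW; rewrite ht.
    by rewrite -e2 //; apply: (proj1 k2); rewrite /= t1 ht'.
  apply: (@cts_on_sub _ _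
    ([set t : R | 0 <= t <= 2^-1] `|` [set t : R | 2^-1 <= t <= 1])).
    move=> t /= /andP[t0 t1]; have [ht | ht] := leP t 2^-1.
      by left; rewrite t0.
    by right; rewrite ltW.
  apply: cts_on_setU => //.
    by apply: cts_on_eq (proj2 k1) => t /andP[_ ht]; exact: e1.
  by apply: cts_on_eq (proj2 k2) => t /andP[ht _]; exact: e2.
- by rewrite /k invr_ge0 ler0n mulr0.
- rewrite -e2; last by rewrite invf_le1 // ler1n.
  rewrite /h'' /= (_ : 2 * 1 - 1 = 1) ?h1'; last by ring.
  by rewrite mobius_comp ?(hp_grp_det Gg) ?(hp_grp_det Gg') ?(hp_dom_gt0 Xx).
Qed.

(** The edges t = 0 and t = 1 of the lifted square are lifts of the same path, so one group element
    relates them for every s. *)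
Lemma homotopy_lift (R : realType) (P : hyp_pants R) (F : R * R -> P) :
  {within `[0, 1] `*` `[0, 1], continuous F} ->
  (forall s, 0 <= s <= 1 -> F (s, 0) = F (s, 1)) ->
  exists h g, [/\ hp_grp P g, is_lift (rect 0 1 0 1) F h &
    forall s, 0 <= s <= 1 -> lifts_to (fun t => F (s, t)) (h (s, 0)) g].
Proof.
move=> /within_cts_on cF F01.
have [|h l] := @rect_lift _ P F.
  apply: cts_on_sub cF => -[s t]; rewrite /rect /= => -[hs ht].
  by split; rewrite /= in_itv.
have vert (u : R) : is_lift [set t : R | 0 <= t <= 1] (fun t => F (u, t))
    (fun t => h (u, t)) \/ ~ (0 <= u <= 1).
  have [hu | hu] := pselect (0 <= u <= 1); last by right.
  left.
  apply: (@is_lift_comp _ _ _ _ _ (rect 0 1 0 1) F h (fun t => (u, t))) => //.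
  apply: continuous_cts_on => t _; exact: (cvg_pair (cvg_cst _) cvg_id).
have hor (u : R) : 0 <= u <= 1 -> is_lift [set t : R | 0 <= t <= 1]
    (fun t => F (t, u)) (fun t => h (t, u)).
  move=> hu.
  apply: (@is_lift_comp _ _ _ _ _ (rect 0 1 0 1) F h (fun t => (t, u))) => //.
  apply: continuous_cts_on => t _; exact: (cvg_pair cvg_id (cvg_cst _)).
have [|||g Gg hg] := @is_lift_uniq _ P 0 1 (fun s => F (s, 0))
  (fun s => h (s, 0)) (fun s => h (s, 1)).
- exact: ler01.
- by apply: hor; rewrite lexx ler01.
- apply: (is_lift_eq (F := fun s => F (s, 1))) => [s hs|]; first by rewrite F01.
  by apply: hor; rewrite lexx ler01.
exists h, g; split => // s hs; split=> //; exists (fun t => h (s, t)).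
by split=> //; [case: (vert s) | exact: hg].
Qed.

Lemma lifts_to_free (R : realType) (P : hyp_pants R) (f f' : R -> P) x :
  freely_homotopic f f' -> hp_dom P x -> hp_proj P x = f 0 ->
  exists g x', lifts_to f x g /\ lifts_to f' x' g.
Proof.
case=> F [cF F0 F1 F01] Xx fx.
have [h [g [Gg l hg]]] := homotopy_lift cF F01.
have i0 : 0 <= (0 : R) <= 1 by rewrite lexx ler01.
have i1 : 0 <= (1 : R) <= 1 by rewrite lexx ler01.
have l0 := lifts_to_eq F0 (hg 0 i0); have l1 := lifts_to_eq F1 (hg 1 i1).
have [Xh fh] := lifts_to_base l0.
have [k Gk hk] := (hp_proj_eq Xh Xx).1 (etrans fh (esym fx)).
exists (k *m g *m invmx k), (mobius k (h (1, 0))); split.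
  by rewrite hk; exact: lifts_to_conj.
exact: lifts_to_conj.
Qed.

(** The base point does not move, so its lifted track is constant by uniqueness of lifts, and both
    loops have the same monodromy at the same point. *)
Lemma lifts_to_based (R : realType) (P : hyp_pants R) (f f' : R -> P) x0 x g :
  loop_homotopic x0 f f' -> lifts_to f x g -> lifts_to f' x g.
Proof.
case=> F [cF F0 F1 F01] fg; have [Xx fx] := lifts_to_base fg.
have [|h [g' [Gg' l hg]]] := homotopy_lift cF.
  by move=> s hs; have [-> ->] := F01 s hs.
have i0 : 0 <= (0 : R) <= 1 by rewrite lexx ler01.
have i1 : 0 <= (1 : R) <= 1 by rewrite lexx ler01.
have l0 := lifts_to_eq F0 (hg 0 i0); have l1 := lifts_to_eq F1 (hg 1 i1).
have [Xh fh] := lifts_to_base l0.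
have [k Gk hk] := (hp_proj_eq Xh Xx).1 (etrans fh (esym fx)).
have [|||g1 Gg1 hg1] := @is_lift_uniq _ P 0 1 (fun s => F (s, 0))
  (fun s => h (0, 0)) (fun s => h (s, 0)).
- exact: ler01.
- split; last by apply: continuous_cts_on => s _; exact: cvg_cst.
  by move=> s /F01 [-> _]; split=> //; rewrite fh -F0 //; case: (F01 0 i0).
- apply: (@is_lift_comp _ _ _ _ _ (rect 0 1 0 1) F h (fun t => (t, 0))) => //.
  apply: continuous_cts_on => t _; exact: (cvg_pair cvg_id (cvg_cst _)).
have e1 : mobius g1 (h (0, 0)) = mobius 1%:M (h (0, 0)).
  by rewrite -(hg1 0 i0) mobius1.
have e2 : h (1, 0) = h (0, 0).
  rewrite (hg1 1 i1); case: (hp_grp_eq Gg1 (hp_grp1 P) Xh e1) => ->;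
  by rewrite ?mobiusN mobius1.
have m0 := lifts_to_conj Gk l0; have m1 := lifts_to_conj Gk l1.
rewrite e2 -hk in m1; rewrite -hk in m0.
exact: lifts_to_opp (proj1 fg) (lifts_to_uniq m0 fg) m1.
Qed.

(** * Monodromy of closed geodesics and boundary curves *)

Lemma hp_proj_mobius (R : realType) (P : hyp_pants R) g z : hp_grp P g ->
  hp_dom P z -> hp_proj P (mobius g z) = hp_proj P z.
Proof.
move=> Gg Xz; apply/esym/hp_proj_eq => //; last by exists g.
exact: hp_grp_act.
Qed.

(* If the loop f develops into a curve invariant under T, then its monodromy
   is conjugate to T in the group of P, up to sign. *)
Lemma lifts_to_period (R : realType) (P : hyp_pants R) (f : R -> P)
    (d : R -> R * R) (k T : 'M[R]_2) x g :
  \det k = 1 -> \det T = 1 -> continuous d -> (forall t, 0 < (d t).2) ->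
  d 0 <> d 1 -> (forall t, d (t + 1) = mobius T (d t)) ->
  (forall t, f (t + 1) = f t) ->
  (forall t, hp_dom P (mobius k (d t)) /\ f t = hp_proj P (mobius k (d t))) ->
  lifts_to f x g ->
  exists2 m, hp_grp P m & g = m *m k *m T *m invmx (m *m k) \/
    g = - (m *m k *m T *m invmx (m *m k)).
Proof.
move=> hk hT cd d0 d01 dT f1 fk [Gg [h [l h0 h1]]].
have i0 : 0 <= (0 : R) <= 1 by rewrite lexx ler01.
have i1 : 0 <= (1 : R) <= 1 by rewrite lexx ler01.
have lk : is_lift [set t : R | 0 <= t <= 1] f (mobius k \o d).
  split; first by move=> t _; have [Xt ->] := fk t.
  apply: (@cts_on_comp _ _ _ _ (@halfplane R)).
  - by apply: continuous_cts_on => t _; exact: cd.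
  - by apply: continuous_cts_on => z hz; exact: mobius_cont.
  - by move=> t _; exact: d0.
(* By periodicity of [f], the development shifted by one period is again a lift of [f]. *)
have lk1 : is_lift [set t : R | 0 <= t <= 1] f (mobius k \o (mobius T \o d)).
  split.
    by move=> t _; rewrite /= -dT; have [Xt <-] := fk (t + 1).
  apply: (@cts_on_comp _ _ _ _ (@halfplane R)).
  - apply: (@cts_on_comp _ _ _ _ (@halfplane R)).
    + by apply: continuous_cts_on => t _; exact: cd.
    + by apply: continuous_cts_on => z hz; exact: mobius_cont.
    + by move=> t _; exact: d0.
  - by apply: continuous_cts_on => z hz; exact: mobius_cont.
  - by move=> t _; apply: mobius_gt0 => //; exact: d0.
have [m Gm hm] := is_lift_uniq ler01 lk l.
have [g1 Gg1 hg1] := is_lift_uniq ler01 lk lk1.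
have hdm := hp_grp_det Gm; have hdg := hp_grp_det Gg.
have hdg1 := hp_grp_det Gg1.
have hmk := det1M hdm hk.
exists m => //.
have X0 : hp_dom P (mobius k (d 0)) by case: (fk 0).
have [g2 Gg2 eg2] : exists2 g2, hp_grp P g2 & g2 = m *m g1 *m invmx m.
  exists (m *m g1 *m invmx m) => //.
  by apply: hp_grpM; [exact: hp_grpM | exact: hp_grpV].
have kd t : 0 < (mobius k (d t)).2 by rewrite mobius_gt0.
have act t : 0 <= t <= 1 ->
    mobius g2 (mobius (m *m k) (d t)) = mobius (m *m k) (mobius T (d t)).
  move=> ht; rewrite (mobius_comp hdm hk (d0 t)) eg2 mobius_conj //.
  rewrite (mobius_comp hdm hk (mobius_gt0 hT (d0 t))); congr (mobius m _).
  by rewrite -[LHS](hg1 t ht).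
have gg2 : g = g2 \/ g = - g2.
  apply: (@hp_grp_eq _ P _ _ (mobius (m *m k) (d 0))) => //.
    by rewrite mobius_comp //; exact: hp_grp_act.
  rewrite (act 0 i0) -dT add0r !(mobius_comp hdm hk (d0 _)).
  have := hm 0 i0; have := hm 1 i1; rewrite /= => <- <-.
  by rewrite h1 h0.
(* Both matrices agree at the two distinct points developed from [d 0] and [d 1], which determines
   them up to sign. *)
have [] := @mobius_eq2 _ g2 (m *m k *m T *m invmx (m *m k))
  (mobius (m *m k) (d 0)) (mobius (m *m k) (d 1)); rewrite ?mobius_gt0 //.
- exact: hp_grp_det Gg2.
- exact: det_conj1.
- move=> /(congr1 (mobius (invmx (m *m k)))); rewrite !mobiusK //.
- by rewrite (act 0 i0) mobius_conj.
- by rewrite (act 1 i1) mobius_conj.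
- by move=> <-.
- by move=> e; case: gg2 => ->; rewrite e ?opprK; auto.
Qed.

Definition end_level (R : realType) (P : hyp_pants R) (i : hole)
    (z : R * R) : R :=
  hole_level i (hp_mark (hp_proj P z)).

Lemma far_end_levels (R : realType) (P : hyp_pants R) (i j : hole) : i <> j ->
  far_levels (hp_dom P) (end_level P i) (end_level P j).
Proof.
(* At level 1/2 the two discs grow to radius sqrt (3/2) < 2, so they stay apart and inside radius 4,
   while the outer collar is |z|^2 > 49/2. *)
move=> ij; exists 2^-1; first by rewrite invr_gt0.
move=> z _; rewrite /end_level; case: (hp_mark _) => x y.
by case: i j ij => [] [] //= _; nra.
Qed.

(** Read in a frame of its axis, the geodesic advances by L in one period. The frame is then moved
    by a group element so that it fits the given lift. *)
Lemma closed_geodesic_lift (R : realType) (P : hyp_pants R) (gam : R -> P)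
    (L : R) x g : closed_geodesic gam L -> lifts_to gam x g ->
  exists k, [/\ \det k = 1, (forall E, 0 < E -> hp_dom P (mobius k (0, E))),
    (forall t, gam t = hp_proj P (mobius k (0, expR (L * t)))) &
    g = k *m diagmx L *m invmx k \/ g = - (k *m diagmx L *m invmx k)].
Proof.
move=> [L0 per [s [gs Xs es]]] lg.
have [k hk sE] := geodesic_line_axis gs.
have [|||||m Gm hg] := @lifts_to_period _ P gam (fun t => (0, expR (L * t)))
  k (diagmx L) x g hk (det_diagmx L) _ _ _ _ per _ lg.
- move=> t; suff c : expR (L * u) @[u --> t] --> expR (L * t).
    exact: (cvg_pair (cvg_cst _) c).
  apply: (@continuous_comp _ _ _ (fun t : R => L * t) (@expR R)).
    by apply: cvgM; [exact: cvg_cst | exact: cvg_id].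
  exact: continuous_expR.
- by move=> t /=; exact: expR_gt0.
- move=> [] /eqP; rewrite mulr0 mulr1 expR0 => /eqP e.
  by move: L0; rewrite -expR_gt1 -e ltxx.
- by move=> t; rewrite mobius_diagmx -expRD; congr (_, expR _); ring.
- by move=> t; rewrite -sE.
have dm := hp_grp_det Gm.
have XE E : 0 < E -> hp_dom P (mobius k (0, E)).
  by move=> E0; rewrite -[E]lnK // -sE.
exists (m *m k); split => //.
- exact: det1M.
- by move=> E E0; rewrite mobius_comp //; apply: hp_grp_act => //; exact: XE.
- move=> t; rewrite mobius_comp ?expR_gt0 // hp_proj_mobius //.
    by rewrite -sE.
  by apply: XE; exact: expR_gt0.
Qed.

Lemma periodic_01 (R : realType) (T : Type) (f : R -> T) :
  (forall t, f (t + 1) = f t) -> forall t, exists2 u, 0 <= u <= 1 & f t = f u.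
Proof.
move=> per t.
have pern (n : nat) u : f (u + n%:R) = f u.
  elim: n => [|n IH]; first by rewrite addr0.
  by rewrite -addn1 natrD addrA per.
have perz (n : int) u : f (u + n%:~R) = f u.
  case: n => n; first exact: pern.
  by rewrite NegzE mulrNz -[in RHS](subrK n.+1%:R u) pern.
exists (t - (Num.floor t)%:~R).
  have := floor_le t; have := floorD1_gt t; rewrite intrD => h1 h2.
  by apply/andP; split; lra.
by rewrite -{1}(subrK (Num.floor t)%:~R t) perz.
Qed.

(** A horocycle develops with a parabolic period, a boundary geodesic with a hyperbolic one. The
    frame is chosen with the region on its positive side, and the sign records the direction of
    travel. *)
Lemma boundary_curve_lift (R : realType) (P : hyp_pants R) (i : hole)
    (bd : R -> P) (l : R) x g : boundary_curve i bd l -> lifts_to bd x g ->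
  exists T sg n, end_mx (hp_dom P) (end_level P i) T l sg n /\
    (g = T \/ g = - T).
Proof.
rewrite /boundary_curve; case: ifP => [cusp_i | _].
  move=> [-> [k [Y [y [[hk Y0 XY par [lev _]] Yy hbd]]]]] lg.
  have [sg hsg bdE] : exists2 sg : R, sg = 1 \/ sg = -1 &
      forall t, bd t = hp_proj P (mobius k (sg * t, y)).
    case: hbd => hbd; [exists 1 | exists (-1)]; rewrite ?mul1r; auto => t.
      by rewrite mul1r.
    by rewrite mulN1r.
  have y0 : 0 < y by exact: lt_trans Y0 Yy.
  (* One turn around the cusp is a translation by an integer, which is what the chart identifies. *)
  have sgz : exists n : int, sg = n%:~R.
    by case: hsg => ->; [exists 1 | exists (-1)]; rewrite ?mulrN1z.
  have [||||||m Gm hg] := @lifts_to_period _ P bd (fun t => (sg * t, y))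
    k (transl_mx sg) x g hk (det_transl_mx sg) _ _ _ _ _ _ lg.
  - move=> t; suff c : sg * u @[u --> t] --> sg * t.
      exact: (cvg_pair c (cvg_cst _)).
    by apply: cvgM; [exact: cvg_cst | exact: cvg_id].
  - by [].
  - move=> [] /eqP; rewrite mulr0 mulr1 eq_sym; case: hsg => ->;
    by rewrite ?oppr_eq0 oner_eq0.
  - by move=> t; rewrite mobius_transl_mx /= mulrDr mulr1.
  - move=> t; rewrite !bdE; apply/esym/par => //; have [n sgn] := sgz.
    by exists n; rewrite -sgn mulrDr mulr1.
  - by move=> t; split; [exact: XY | exact: bdE].
  have dm := hp_grp_det Gm; have dmk := det1M dm hk.
  exists (m *m k *m transl_mx sg *m invmx (m *m k)), sg, (dual_cusp (m *m k)).
  split=> //; split=> //; right; split=> //; exists (m *m k); split=> //.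
  split=> //; exists Y; split=> //.
    move=> z Yz; rewrite mobius_comp // ?(lt_trans Y0) //.
    by apply: hp_grp_act => //; exact: XY.
  move=> e e0; have [Y' hY'] := lev e e0; exists Y' => z Yz Yz'.
  rewrite mobius_comp // ?(lt_trans Y0) // /end_level hp_proj_mobius //.
    exact: hY'.
  exact: XY.
move=> [geod im _] lg.
have [k [hk Xk bdE hg]] := closed_geodesic_lift geod lg.
have [L0 per _] := geod.
(* Every point of the axis projects into the image of one period of [bd], which is the zero level of
   the hole. *)
have lev0 E : 0 < E -> end_level P i (mobius k (0, E)) = 0.
  move=> E0; have [u hu eu] := periodic_01 per (ln E / l).
  have : (bd @` `[0, 1]) (bd u) by exists u => //; rewrite /= in_itv.
  rewrite im /= -eu bdE mulrC divfK ?gt_eqF // lnK //.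
have nI : ~ (hp_dom P)° (mobius k (0, 1)).
  apply/(hp_mark_bd (Xk _ ltr01)); exists i; exact: lev0.
case: (boundary_one_side (hp_domP P) hk Xk nI) => side.
  exists (k *m diagmx (1 * l) *m invmx k), 1, (dual_geod k).
  split; last by rewrite mul1r.
  split; first by left.
  left; split=> //; exists k; split=> //; split=> // E E0.
  split; last exact: lev0.
  exact: Xk.
(* Here the region is on the negative side. Composing the frame with the half-turn exchanges the
   sides and inverts the translation, whence the sign -1. *)
have hf := det_flipmx R; have hkf := det1M hk hf.
have eT : k *m flipmx R *m diagmx (- 1 * l) *m invmx (k *m flipmx R) =
    k *m diagmx l *m invmx k.
  rewrite invmx_mul // /flipmx (invmx_mx2 (a := 0)); last by ring.
  rewrite !mulmxA; congr (_ *m _); rewrite -!mulmxA; congr (_ *m _).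
  by rewrite /diagmx !mul_mx2 mulN1r mulNr opprK; congr mx2; ring.
exists (k *m diagmx l *m invmx k), (-1), (dual_geod (k *m flipmx R)).
split=> //; split; first by right.
left; split=> //; exists (k *m flipmx R); split=> //; split=> //.
  move=> [u v] /= v0; rewrite mobius_comp // => /side; rewrite mobius_gt0 //.
  move=> /(_ isT); have D0 := mobius_den_gt0 u (_ : 0 * 0 - -1 * 1 = 1) v0.
  rewrite mobius_mx2 pmulr_lle0 ?invr_gt0 ?D0 //; last by ring.
  by nra.
move=> E E0; rewrite mobius_comp // mobius_flipmx //; split.
  by apply: Xk; rewrite invr_gt0.
by apply: lev0; rewrite invr_gt0.
Qed.

(** * The trace identity for the three boundary monodromies *)

Theorem theorem1p3 (R : realType) (P : hyp_pants R)
    (bd_a bd_b bd_c : R -> P) (l_a l_b l_c : R)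
    (bd_aP : boundary_curve hole_a bd_a l_a)
    (bd_bP : boundary_curve hole_b bd_b l_b)
    (bd_cP : boundary_curve hole_c bd_c l_c)
    (x0 : P) (a b c : R -> P)
    (a_loop : loop_at x0 a) (b_loop : loop_at x0 b) (c_loop : loop_at x0 c)
    (a_bd : freely_homotopic a bd_a)
    (b_bd : freely_homotopic b bd_b)
    (c_bd : freely_homotopic c bd_c)
    (c_ab : loop_homotopic x0 c (loop_inv (loop_mul a b)))
    (gam : R -> P) (l_gam : R)
    (gam_geod : closed_geodesic gam l_gam)
    (gam_ab : freely_homotopic gam (loop_mul (loop_inv a) b)) :
  coshR (l_gam / 2) = 2 * coshR (l_a / 2) * coshR (l_b / 2) + coshR (l_c / 2).
Proof.
have [x Xx px] := hp_proj_surj x0.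
have [A [xa [lA lA']]] :=
  lifts_to_free a_bd Xx (etrans px (esym (proj2 a_loop))).
have [B [xb [lB lB']]] :=
  lifts_to_free b_bd Xx (etrans px (esym (proj2 b_loop))).
have [C [xc [lC lC']]] :=
  lifts_to_free c_bd Xx (etrans px (esym (proj2 c_loop))).
(* All three loops are lifted from the same point x, so C is the inverse of A B up to sign. *)
have eC := lifts_to_uniq (lifts_to_based c_ab lC)
  (lifts_to_inv (lifts_to_mul lA lB)).
have lAB := lifts_to_mul (lifts_to_inv lA) lB.
have [y Xy py] := hp_proj_surj (gam 0).
have [D [y' [lD lD']]] := lifts_to_free gam_ab Xy py.
have [k [hk _ _ eD]] := closed_geodesic_lift gam_geod lD.
have [Xy' py'] := lifts_to_base lD'; have [_ px'] := lifts_to_base lAB.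
(* The free homotopy only gives a lift from some y' over the base point; m moves y' to x, so that D
   is conjugate to A^-1 B up to sign. *)
have [m Gm em] := (hp_proj_eq Xy' Xx).1 (etrans py' (esym px')).
have := lifts_to_conj Gm lD'; rewrite -em => lD2.
have eD2 := lifts_to_uniq lD2 lAB.
have [TA [sa [na [eA A_TA]]]] := boundary_curve_lift bd_aP lA'.
have [TB [sb [nb [eB B_TB]]]] := boundary_curve_lift bd_bP lB'.
have [TC [sc [nc [eC' C_TC]]]] := boundary_curve_lift bd_cP lC'.
have dA := end_mx_det eA; have dB := end_mx_det eB; have dC := end_mx_det eC'.
have trE lev T l sg n : end_mx (hp_dom P) lev T l sg n ->
    \tr T = 2 * coshR (l / 2).
  move=> /end_mxE [n0 ->]; rewrite mxtraceD !mxtraceZ n0 mxtrace1; ring.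
have trV (g : 'M[R]_2) : \det g = 1 -> \tr (invmx g) = \tr g.
  by move=> hg; rewrite invmx_tr // raddfB /= mxtrace_scalar; ring.
have eABC : A *m B *m C = 1%:M \/ A *m B *m C = - 1%:M.
  have u : A *m B \in unitmx.
    apply: mx2_det1_unit.
    apply: det1M; first exact: hp_grp_det (proj1 lA).
    exact: hp_grp_det (proj1 lB).
  by case: eC => ->; rewrite ?mulmxN mulmxV //; auto.
(* Passing to the representatives of positive trace changes the product at most by a sign. *)
have {eABC} eT : TA *m TB *m TC = 1%:M \/ TA *m TB *m TC = - 1%:M.
  have opp (g : 'M[R]_2) : - g = 1%:M \/ - g = - 1%:M -> g = 1%:M \/ g = - 1%:M.
    by case=> [<- | /oppr_inj ->]; rewrite ?opprK; auto.
  by case: A_TA B_TB C_TC eABC => -> [] -> [] ->;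
    rewrite ?(mulNmx, mulmxN, opprK) // => /opp.
(* The product 1 is excluded by the comparison of the three lengths, which leaves -1. *)
have eTAB : TA *m TB = - invmx TC.
  have far := @far_end_levels _ P.
  case: eT => [e | e].
    by case: (end_triple (far _ _ _) (far _ _ _) (far _ _ _) eA eB eC' e).
  by rewrite -[LHS](mulmxK (mx2_det1_unit dC)) e mulNmx mul1mx.
have trAB : \tr (invmx TA *m TB) =
    2 * (2 * coshR (l_a / 2) * coshR (l_b / 2) + coshR (l_c / 2)).
  rewrite invmx_tr // mulmxBl mul_scalar_mx eTAB opprK mxtraceD mxtraceZ trV //.
  by rewrite (trE _ _ _ _ _ eA) (trE _ _ _ _ _ eB) (trE _ _ _ _ _ eC'); ring.
have invA : invmx A = invmx TA \/ invmx A = - invmx TA.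
  by case: A_TA => ->; [left | right; exact: invmxN].
(* From here on only absolute values of traces are compared, as deck transformations are known up to
   sign. *)
have nAB : `|\tr (invmx A *m B)| = `|\tr (invmx TA *m TB)|.
  by case: invA B_TB => -> [] ->;
    rewrite ?(mulNmx, mulmxN, opprK) ?raddfN ?normrN.
have nD : `|\tr D| = 2 * coshR (l_gam / 2).
  have tk : \tr (k *m diagmx l_gam *m invmx k) = 2 * coshR (l_gam / 2).
    by rewrite mxtrace_mulC mulKmx ?mx2_det1_unit // mxtrace_mx2 /coshR; field.
  have c1 := coshR_ge1 (l_gam / 2).
  by case: eD => ->; rewrite ?raddfN ?normrN /= tk ger0_norm // mulr_ge0 //;
    lra.
have nD2 : `|\tr D| = `|\tr (invmx A *m B)|.
  transitivity `|\tr (m *m D *m invmx m)|.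
    by rewrite mxtrace_mulC mulKmx // mx2_det1_unit // (hp_grp_det Gm).
  by case: eD2 => ->; rewrite ?raddfN ?normrN.
have two : 2 != 0 :> R by rewrite pnatr_eq0.
move: nD; rewrite nD2 nAB trAB ger0_norm; first by move/(mulfI two) => ->.
have := coshR_ge1 (l_a / 2); have := coshR_ge1 (l_b / 2).
have := coshR_ge1 (l_c / 2); nra.
Qed.
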